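(* Let $(N^{2n+1},\varphi,\xi,\eta,g)$ be a Sasakian space form with constant $\varphi$-sectional curvature $c$, and let $\mathbf{i}:M^n\to N^{2n+1}$ be an $n$-dimensional integral submanifold of $N$. Then $M$ is biharmonic (i.e. $\mathbf{i}$ is a biharmonic map) if and only if $$ \begin{cases} \Delta^{\perp}H+\operatorname{trace} B(\cdot,A_{H}\cdot)-\dfrac{c(n+3)+3n-3}{4}H=0,\\[4pt] 4\operatorname{trace} A_{\nabla^{\perp}_{(\cdot)}H}(\cdot)+n\operatorname{grad}(|H|^{2})=0. \end{cases} $$
   Context: Everything is smooth; manifolds are connected. A contact metric structure on $N^{2n+1}$ is $(\varphi,\xi,\eta,g)$ with $\varphi$ a $(1,1)$-tensor field, $\xi$ a vector field, $\eta$ a 1-form, $g$ a Riemannian metric such that $\varphi^2=-I+\eta\otimes\xi$, $\eta(\xi)=1$, $g(\varphi U,\varphi V)=g(U,V)-\eta(U)\eta(V)$, $g(U,\varphi V)=d\eta(U,V)$. It is Sasakian if $(\nabla^N_U\varphi)(V)=g(U,V)\xi-\eta(V)U$ for all vector fields $U,V$; then $\nabla^N_U\xi=-\varphi U$. The $\varphi$-sectional curvature is the sectional curvature of the planes spanned by $U,\varphi U$ with $U$ a unit vector orthogonal to $\xi$; a Sasakian space form $N(c)$ is a Sasakian manifold with constant $\varphi$-sectional curvature $c$. An integral submanifold $M$ of $N$ is a submanifold (with induced metric) with $\eta(X)=0$ for all $X$ tangent to $M$. $B$ is the second fundamental form of $M$ in $N$, $A$ the shape operator, $H$ the mean curvature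 vector field normalized by $nH=\operatorname{trace}B$, $\nabla^{\perp}$ the normal connection, and $\Delta^\perp=-\operatorname{trace}(\nabla^\perp)^2$ the Laplacian in the normal bundle. For an orthonormal frame $\{X_i\}$ on $M$, $\operatorname{trace}B(\cdot,A_H\cdot)=\sum_i B(X_i,A_HX_i)$ and $\operatorname{trace}A_{\nabla^\perp_{(\cdot)}H}(\cdot)=\sum_i A_{\nabla^\perp_{X_i}H}X_i$. A map $\psi:(M,g)\to(N,h)$ is biharmonic if it is a critical point of the bienergy $E_2(\psi)=\frac12\int_M|\tau(\psi)|^2v_g$, where $\tau(\psi)=\operatorname{trace}\nabla d\psi$; equivalently $\tau_2(\psi)=-\Delta\tau(\psi)-\operatorname{trace}R^N(d\psi,\tau(\psi))d\psi=0$, where $\Delta=-\operatorname{trace}\nabla^2$ is the rough Laplacian on sections of $\psi^{-1}TN$ and $R^N(X,Y)=[\nabla_X,\nabla_Y]-\nabla_{[X,Y]}$. A submanifold is biharmonic if its inclusion map is biharmonic. *)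

(* Defs.v *)
From HB Require Import structures.
From mathcomp Require Import all_boot all_order all_algebra.
From mathcomp Require Import all_classical all_reals all_analysis.
Set Implicit Arguments.
Unset Strict Implicit.
Unset Printing Implicit Defensive.
Import Order.TTheory GRing.Theory Num.Theory.
Import numFieldNormedType.Exports.
Local Open Scope classical_set_scope.
Local Open Scope ring_scope.

(** * Smooth functions between finite-dimensional normed spaces *)

Section Smooth.
Context {R : realType} {V W : normedModType R}.

Fixpoint iter_derive (s : seq V) (f : V -> W) : V -> W :=
  if s is v :: s' then (fun x => 'D_v (iter_derive s' f) x) else f.

(** Used with [U] open and [V] finite dimensional, where it is C^oo on [U]. *)
Definition smooth_on (U : set V) (f : V -> W) :=
  forall (s : seq V) (x : V), U x -> differentiable (iter_derive s f) x.

End Smooth.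

(** * Smooth manifolds *)

Record chart (R : realType) (T : topologicalType) (m : nat) := Chart {
  dom : set T;
  coord : T -> 'rV[R]_m;
  param : 'rV[R]_m -> T;
  open_dom : open dom;
  open_cod : open (coord @` dom);
  coordK : forall p, dom p -> param (coord p) = p;
  coord_continuous : {within dom, continuous coord};
  param_continuous : {within coord @` dom, continuous param} }.

Section Charts.
Context {R : realType} {T : topologicalType} {m : nat}.
Implicit Types x y : chart R T m.

Definition cod x : set 'rV[R]_m := coord x @` dom x.
Definition overlap x y : set 'rV[R]_m := coord x @` (dom x `&` dom y).
Definition transition x y : 'rV[R]_m -> 'rV[R]_m := coord y \o param x.

End Charts.

Record manifold (R : realType) (m : nat) := Manifold {
  carrier :> topologicalType;
  atlas : set (chart R carrier m);
  manifold_hausdorff : hausdorff_space carrier;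
  manifold_second_countable : @second_countable carrier;
  manifold_connected : connected [set: carrier];
  atlas_cover : forall p, exists2 x, atlas x & dom x p;
  atlas_compatible : forall x y, atlas x -> atlas y ->
    smooth_on (overlap x y) (transition x y) }.

(** Tensor fields are families of components, one per chart, transforming with
    the Jacobian matrices of the changes of coordinates.  Tangent vectors are
    row vectors: ['J f u] acts on them on the right, ['D_v f u = v *m 'J f u],
    and so do (1,1)-tensors; 1-forms are column vectors. *)
Section Tensors.
Context {R : realType} {m : nat}.

Record vector_field (N : manifold R m) := VectorField {
  vf_comp :> chart R N m -> 'rV[R]_m -> 'rV[R]_m;
  vf_smooth : forall x, atlas x -> smooth_on (cod x) (vf_comp x);
  vf_transform : forall x y u, atlas x -> atlas y -> overlap x y u ->
    vf_comp x u *m 'J (transition x y) u = vf_comp y (transition x y u) }.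

Record one_form (N : manifold R m) := OneForm {
  form_comp :> chart R N m -> 'rV[R]_m -> 'cV[R]_m;
  form_smooth : forall x, atlas x -> smooth_on (cod x) (form_comp x);
  form_transform : forall x y u, atlas x -> atlas y -> overlap x y u ->
    form_comp x u = 'J (transition x y) u *m form_comp y (transition x y u) }.

Record tensor11 (N : manifold R m) := Tensor11 {
  t11_comp :> chart R N m -> 'rV[R]_m -> 'M[R]_m;
  t11_smooth : forall x, atlas x -> smooth_on (cod x) (t11_comp x);
  t11_transform : forall x y u, atlas x -> atlas y -> overlap x y u ->
    t11_comp x u *m 'J (transition x y) u =
    'J (transition x y) u *m t11_comp y (transition x y u) }.

Definition ip (G : 'M[R]_m) (v w : 'rV[R]_m) : R := (v *m G *m w^T) 0 0.

Definition pairing (a : 'cV[R]_m) (v : 'rV[R]_m) : R := (v *m a) 0 0.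

Record riemannian_metric (N : manifold R m) := RiemannianMetric {
  metric_comp :> chart R N m -> 'rV[R]_m -> 'M[R]_m;
  metric_smooth : forall x, atlas x -> smooth_on (cod x) (metric_comp x);
  metric_transform : forall x y u, atlas x -> atlas y -> overlap x y u ->
    metric_comp x u = 'J (transition x y) u
      *m metric_comp y (transition x y u) *m ('J (transition x y) u)^T;
  metric_sym : forall x u, atlas x -> cod x u ->
    (metric_comp x u)^T = metric_comp x u;
  metric_pos : forall x u v, atlas x -> cod x u -> v != 0 ->
    0 < ip (metric_comp x u) v v }.

End Tensors.

(** * Riemannian geometry in a chart

    [h u] is the Gram matrix of the metric in the coordinate frame at [u]. *)
Section LeviCivita.
Context {R : realType} {m : nat}.
Implicit Types (h : 'rV[R]_m -> 'M[R]_m) (X Y Z : 'rV[R]_m -> 'rV[R]_m).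

Definition christoffel h (u : 'rV[R]_m) (k i j : 'I_m) : R :=
  2^-1 * \sum_l invmx (h u) k l *
    ('D_(delta_mx 0 i) (fun w => h w j l) u
     + 'D_(delta_mx 0 j) (fun w => h w i l) u
     - 'D_(delta_mx 0 l) (fun w => h w i j) u).

Definition christoffel_form h (u v w : 'rV[R]_m) : 'rV[R]_m :=
  \row_k \sum_i \sum_j christoffel h u k i j * v 0 i * w 0 j.

Definition levi_civita h X Y (u : 'rV[R]_m) : 'rV[R]_m :=
  'D_(X u) Y u + christoffel_form h u (X u) (Y u).

Definition lie_bracket X Y (u : 'rV[R]_m) : 'rV[R]_m :=
  'D_(X u) Y u - 'D_(Y u) X u.

Definition curvature h X Y Z (u : 'rV[R]_m) : 'rV[R]_m :=
  levi_civita h X (levi_civita h Y Z) u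
  - levi_civita h Y (levi_civita h X Z) u
  - levi_civita h (lie_bracket X Y) Z u.

(** Value of the curvature tensor on tangent vectors at [u]; by tensoriality
    any extension to vector fields will do, here the constant one. *)
Definition curvature_at h (u v w z : 'rV[R]_m) : 'rV[R]_m :=
  curvature h (cst v) (cst w) (cst z) u.

Definition sectional_curvature h (u v w : 'rV[R]_m) : R :=
  ip (h u) (curvature_at h u v w w) v /
  (ip (h u) v v * ip (h u) w w - ip (h u) v w ^+ 2).

(** The convention of contact metric geometry, with the factor 1/2: it is the
    one for which [d eta (U, V) = g (U, phi V)] is compatible with the Sasakian
    condition below. *)
Definition ext_d (a : 'rV[R]_m -> 'cV[R]_m) X Y (u : 'rV[R]_m) : R :=
  2^-1 * ('D_(X u) (fun w => pairing (a w) (Y w)) u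
          - 'D_(Y u) (fun w => pairing (a w) (X w)) u
          - pairing (a u) (lie_bracket X Y u)).

End LeviCivita.

(** * Sasakian space forms *)

Record contact_metric (R : realType) (m : nat) (N : manifold R m) :=
  ContactMetric {
  cm_phi : tensor11 N;
  cm_xi : vector_field N;
  cm_eta : one_form N;
  cm_metric : riemannian_metric N;
  phi_sqr : forall x u, atlas x -> cod x u ->
    cm_phi x u *m cm_phi x u = - 1%:M + cm_eta x u *m cm_xi x u;
  eta_xi : forall x u, atlas x -> cod x u -> pairing (cm_eta x u) (cm_xi x u) = 1;
  metric_phi : forall x u (U V : 'rV[R]_m), atlas x -> cod x u ->
    ip (cm_metric x u) (U *m cm_phi x u) (V *m cm_phi x u) =
    ip (cm_metric x u) U V - pairing (cm_eta x u) U * pairing (cm_eta x u) V;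
  metric_d_eta : forall x u (U V : 'rV[R]_m -> 'rV[R]_m),
    atlas x -> cod x u -> smooth_on (cod x) U -> smooth_on (cod x) V ->
    ip (cm_metric x u) (U u) (V u *m cm_phi x u) = ext_d (cm_eta x) U V u }.

Section Sasakian.
Context {R : realType} {m : nat} {N : manifold R m}.
Variable S : contact_metric N.

(** [U] and [V] range over the vector fields on the domain of the chart. *)
Definition sasakian :=
  forall x u (U V : 'rV[R]_m -> 'rV[R]_m),
    atlas x -> cod x u -> smooth_on (cod x) U -> smooth_on (cod x) V ->
    levi_civita (cm_metric S x) U (fun w => V w *m cm_phi S x w) u
      - levi_civita (cm_metric S x) U V u *m cm_phi S x u
    = ip (cm_metric S x u) (U u) (V u) *: cm_xi S x u
      - pairing (cm_eta S x u) (V u) *: U u.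

Definition constant_phi_sectional_curvature (c : R) :=
  forall x u (U : 'rV[R]_m), atlas x -> cod x u ->
    ip (cm_metric S x u) U U = 1 -> ip (cm_metric S x u) U (cm_xi S x u) = 0 ->
    sectional_curvature (cm_metric S x) u U (U *m cm_phi S x u) = c.

Definition sasakian_space_form (c : R) :=
  sasakian /\ constant_phi_sectional_curvature c.

End Sasakian.

(** * Maps, in coordinates

    [F] is the expression of a map in charts of the source and of the target,
    [k] and [h] the metrics of the source and of the target in these charts.
    A section of the pull-back of the target tangent bundle is a function from
    source coordinates to components in the target chart. *)
Section Maps.
Context {R : realType} {n m : nat}.
Variables (k : 'rV[R]_n -> 'M[R]_n) (h : 'rV[R]_m -> 'M[R]_m).
Variable F : 'rV[R]_n -> 'rV[R]_m.
Implicit Types (X Y Z : 'rV[R]_n -> 'rV[R]_n) (V : 'rV[R]_n -> 'rV[R]_m).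

(** Trace, with respect to [k], of a bilinear [T]: it is
    [\sum_i T X_i X_i] for any [k]-orthonormal frame [X_i]. *)
Definition trace {l : nat}
    (T : ('rV[R]_n -> 'rV[R]_n) -> ('rV[R]_n -> 'rV[R]_n) ->
         'rV[R]_n -> 'rV[R]_l)
    (u : 'rV[R]_n) : 'rV[R]_l :=
  \sum_i \sum_j
    invmx (k u) i j *: T (cst (delta_mx 0 i)) (cst (delta_mx 0 j)) u.

Definition grad (f : 'rV[R]_n -> R) : 'rV[R]_n -> 'rV[R]_n :=
  trace (fun X Y u => 'D_(X u) f u *: Y u).

Definition pushforward X (u : 'rV[R]_n) : 'rV[R]_m := 'D_(X u) F u.

Definition pullback_connection X V (u : 'rV[R]_n) : 'rV[R]_m :=
  'D_(X u) V u + christoffel_form h (F u) (pushforward X u) (V u).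

Definition laplacian
    (D : ('rV[R]_n -> 'rV[R]_n) -> ('rV[R]_n -> 'rV[R]_m) ->
         'rV[R]_n -> 'rV[R]_m) V (u : 'rV[R]_n) : 'rV[R]_m :=
  - trace (fun X Y w => D X (D Y V) w - D (levi_civita k X Y) V w) u.

Definition tension : 'rV[R]_n -> 'rV[R]_m :=
  trace (fun X Y u => pullback_connection X (pushforward Y) u
                      - pushforward (levi_civita k X Y) u).

Definition bitension (u : 'rV[R]_n) : 'rV[R]_m :=
  - laplacian pullback_connection tension u
  - trace (fun X Y w => curvature_at h (F w)
             (pushforward X w) (tension w) (pushforward Y w)) u.

(** From here on, [F] is an isometric immersion. *)

Definition tangent_part V : 'rV[R]_n -> 'rV[R]_n :=
  trace (fun X Y u => ip (h (F u)) (V u) (pushforward X u) *: Y u).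

Definition normal_part V (u : 'rV[R]_n) : 'rV[R]_m :=
  V u - pushforward (tangent_part V) u.

Definition second_fundamental_form X Y : 'rV[R]_n -> 'rV[R]_m :=
  normal_part (pullback_connection X (pushforward Y)).

(** The vector field determined by [k (A_V X, Y) = h (B (X, Y), V)]. *)
Definition shape_operator V X : 'rV[R]_n -> 'rV[R]_n :=
  trace (fun Y Z u => ip (h (F u)) (second_fundamental_form X Y u) (V u)
                      *: Z u).

Definition mean_curvature (u : 'rV[R]_n) : 'rV[R]_m :=
  n%:R^-1 *: trace second_fundamental_form u.

Definition normal_connection X V : 'rV[R]_n -> 'rV[R]_m :=
  normal_part (pullback_connection X V).

Definition sqr_norm V (u : 'rV[R]_n) : R := ip (h (F u)) (V u) (V u).

End Maps.

(** * Maps between manifolds *)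

Section GlobalMaps.
Context {R : realType} {n m : nat} {M : manifold R n} {N : manifold R m}.
Implicit Types (i : M -> N) (x : chart R M n) (y : chart R N m).

Definition local_expr i x y : 'rV[R]_n -> 'rV[R]_m :=
  coord y \o i \o param x.

Definition local_dom i x y : set 'rV[R]_n :=
  coord x @` (dom x `&` i @^-1` dom y).

Definition smooth_map i :=
  continuous i /\
  forall x y, atlas x -> atlas y -> smooth_on (local_dom i x y) (local_expr i x y).

(** [gM] is the metric induced by [i] (so that [i] is an immersion). *)
Definition isometric_immersion (gM : riemannian_metric M)
    (gN : riemannian_metric N) i :=
  smooth_map i /\
  forall x y u (v w : 'rV[R]_n), atlas x -> atlas y -> local_dom i x y u ->
    ip (gM x u) v w =
    ip (gN y (local_expr i x y u))
       ('D_v (local_expr i x y) u) ('D_w (local_expr i x y) u).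

Definition integral_map (a : one_form N) i :=
  forall x y u (v : 'rV[R]_n), atlas x -> atlas y -> local_dom i x y u ->
    pairing (a y (local_expr i x y u)) ('D_v (local_expr i x y) u) = 0.

(** The Euler-Lagrange equation of the bienergy. *)
Definition biharmonic (gM : riemannian_metric M) (gN : riemannian_metric N) i :=
  forall x y u, atlas x -> atlas y -> local_dom i x y u ->
    bitension (gM x) (gN y) (local_expr i x y) u = 0.

End GlobalMaps.

(* Main.v *)
Require Import Defs.
From HB Require Import structures.
From mathcomp Require Import all_boot all_order all_algebra.
From mathcomp Require Import all_classical all_reals all_analysis.
From mathcomp Require Import ring lra.
Import Order.TTheory GRing.Theory Num.Theory.
Import numFieldNormedType.Exports.
Local Open Scope classical_set_scope.
Local Open Scope ring_scope.
Set Implicit Arguments.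
Unset Strict Implicit.
Unset Printing Implicit Defensive.

(** Work at a point of a pair of charts, writing [E_i] for the coordinate frame of
    the submanifold, [D] for the pull-back connection and [K = k^-1].  Since the
    tension field is [n H], the bitension field is [n] times
      [L - tr_K R(E, H) E],  [L = K^ij (D_i D_j H - D_(nabla_i e_j) H)].
    The curvature of a Sasakian space form is determined on the contact
    distribution: the Sasakian condition gives [R(a,b) phi - phi R(a,b)], so that
    the difference between [R] and the model tensor is Kaehler-like with zero
    holomorphic curvature, hence zero.  For an integral submanifold of dimension
    [n], [H] is orthogonal to [xi] and [phi H] is tangent, so the trace is
    [- (c (n + 3) + 3 n - 3) / 4 *: H].  The normal part of [L] is
    [- (Delta^perp H + tr B(., A_H .))] by the Gauss and Weingarten formulas, and
    its tangent part, by metric compatibility and commutation of derivatives, is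
    [- (2 tr A_(nabla^perp H) + n/2 grad |H|^2)].  The bitension field vanishes iff
    both parts do. *)

(** * Smooth functions *)

(** All traces are taken in the coordinate frame with the inverse Gram matrix, so that no
    orthonormal frame has to be constructed; the price is that the tangent part involves derivatives
    of [k^-1]. Directions of differentiation are constant vector fields, which commute, so that
    curvature is a plain commutator of covariant derivatives. The connection of the submanifold
    enters as the tangent component of [D], and the derivative of [n |H|^2], written as the trace of
    [h(D_i E_j, H)], takes the place of Codazzi's equation. Traces over [E_i], [E_j] see the ambient
    curvature symmetrized in these two arguments; it is therefore computed with equal first and
    third arguments and then polarized. The dimension [n] is used to make the [E_i], the [phi E_i]
    and [xi] a frame of the ambient tangent space, which is what makes [phi H] tangent. *)

Section SmoothGeneric.
Context {R : realType} {V W : normedModType R}.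
Implicit Types (U : set V) (f g : V -> W).

Lemma near_open_eq U f g (x : V) : open U -> U x ->
  (forall y, U y -> f y = g y) -> \near x, f x = g x.
Proof.
move=> oU Ux fg; have : nbhs x U by exact: open_nbhs_nbhs.
exact: filterS.
Qed.

Lemma derive_ext U f g (x v : V) : open U -> U x ->
  (forall y, U y -> f y = g y) -> 'D_v f x = 'D_v g x.
Proof. by move=> oU Ux fg; apply/near_eq_derive/(near_open_eq oU Ux fg). Qed.

(** The first-order expansion depends only on the germ; [diff_unique] then identifies the
    differentials, which carries the continuity of ['d f x] over to [g]. *)
Lemma differentiable_near f g (x : V) :
  (\near x, f x = g x) -> differentiable f x -> differentiable g x.
Proof.
move=> fg df; have fgx := nbhs_singleton fg.
have gE : g \o shift x = cst (g x) + 'd f x +o_ (0 : V) id.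
  apply/eqaddoP => e e0.
  have /eqaddoP/(_ e e0) := diff_locally df.
  move: fg; rewrite (near_shift 0 x) subr0; apply: filterS2 => y /= fgy.
  by rewrite !fctE /= fgy fgx.
have E : 'd g x = 'd f x :> (V -> W).
  apply: diff_unique => //; exact: diff_continuous.
by apply/diff_locallyP; rewrite E; split => //; exact: diff_continuous.
Qed.

Lemma differentiable_ext U f g (x : V) : open U -> U x ->
  (forall y, U y -> f y = g y) -> differentiable f x -> differentiable g x.
Proof. by move=> oU Ux fg; apply/differentiable_near/(near_open_eq oU Ux fg). Qed.

(** [iter_derive] puts the last direction outermost; the closure properties are
    proved by induction on the first derivative instead. *)
Fixpoint ndiff (k : nat) U f :=
  (forall x, U x -> differentiable f x) /\
  if k is k'.+1 then forall v, ndiff k' U (fun x => 'D_v f x) else True.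

Lemma ndiff_diff k U f x : ndiff k U f -> U x -> differentiable f x.
Proof. by case: k => [|k] [h _]; exact: h. Qed.

Lemma ndiffW k U f : ndiff k.+1 U f -> ndiff k U f.
Proof.
elim: k f => [|k IH] f [df Df]; split => // v.
exact/IH/Df.
Qed.

Lemma iter_derive_rcons s v f :
  iter_derive (rcons s v) f = iter_derive s (fun x => 'D_v f x).
Proof. by elim: s => //= w s ->. Qed.

Lemma smooth_on_derive U f v : smooth_on U f -> smooth_on U (fun x => 'D_v f x).
Proof. by move=> sf s x Ux; rewrite -iter_derive_rcons; exact: sf. Qed.

Lemma smooth_on_diff U f x : smooth_on U f -> U x -> differentiable f x.
Proof. by move=> sf; exact: (sf [::]). Qed.

Lemma smooth_on_ndiff U f : smooth_on U f <-> forall k, ndiff k U f.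
Proof.
split=> [sf k|cf s x Ux].
  elim: k f sf => [|k IH] f sf; split=> //.
  - by move=> x Ux; exact: smooth_on_diff sf Ux.
  - by move=> x Ux; exact: smooth_on_diff sf Ux.
  - by move=> v; exact/IH/smooth_on_derive.
elim/last_ind: s f cf => [|s v IH] f cf; first exact: (ndiff_diff (cf 0) Ux).
rewrite iter_derive_rcons; apply: IH => k.
by have [_ h] := cf k.+1; exact: h.
Qed.

Lemma ndiff_ext k U f g : open U -> (forall y, U y -> f y = g y) ->
  ndiff k U f -> ndiff k U g.
Proof.
move=> oU; elim: k f g => [|k IH] f g fg [df Df]; split=> //.
- by move=> x Ux; exact: differentiable_ext fg (df x Ux).
- by move=> x Ux; exact: differentiable_ext fg (df x Ux).
by move=> v; apply: IH (Df v) => y Uy; exact: derive_ext fg.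
Qed.

Lemma ndiff_cst k U (c : W) : ndiff k U (fun=> c).
Proof.
elim: k c => [|k IH] c; split=> //; try by move=> x _; exact: differentiable_cst.
move=> v.
have -> : (fun x : V => 'D_v (fun=> c) x) = fun=> 0.
  by apply/funext => x; exact: derive_cst.
exact: IH.
Qed.

Lemma ndiffD k U f g : open U -> ndiff k U f -> ndiff k U g -> ndiff k U (fun x => f x + g x).
Proof.
move=> oU; elim: k f g => [|k IH] f g [df Df] [dg Dg]; split=> //.
- by move=> x Ux; apply: differentiableD; [exact: df|exact: dg].
- by move=> x Ux; apply: differentiableD; [exact: df|exact: dg].
move=> v; apply: ndiff_ext (IH _ _ (Df v) (Dg v)) => // y Uy.
by rewrite -deriveD; [|exact/diff_derivable/df|exact/diff_derivable/dg].
Qed.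

Lemma ndiffZ k U f (c : R) : open U -> ndiff k U f -> ndiff k U (fun x => c *: f x).
Proof.
move=> oU; elim: k f => [|k IH] f [df Df]; split=> //.
- by move=> x Ux; apply: differentiableZ; exact: df.
- by move=> x Ux; apply: differentiableZ; exact: df.
move=> v; apply: ndiff_ext (IH _ (Df v)) => // y Uy.
by rewrite -deriveZ; [|exact/diff_derivable/df].
Qed.

Section Closure.
Variable U : set V.
Hypothesis oU : open U.

Lemma smooth_on_ext f g : (forall y, U y -> f y = g y) ->
  smooth_on U f -> smooth_on U g.
Proof. by move=> fg /smooth_on_ndiff h; apply/smooth_on_ndiff => k; exact: ndiff_ext (h k). Qed.

Lemma smooth_on_cst (c : W) : smooth_on U (fun=> c).
Proof. by apply/smooth_on_ndiff => k; exact: ndiff_cst. Qed.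

Lemma smooth_onD f g : smooth_on U f -> smooth_on U g ->
  smooth_on U (fun x => f x + g x).
Proof.
by move=> /smooth_on_ndiff hf /smooth_on_ndiff hg; apply/smooth_on_ndiff => k; exact: ndiffD.
Qed.

Lemma smooth_onZ f (c : R) : smooth_on U f -> smooth_on U (fun x => c *: f x).
Proof. by move=> /smooth_on_ndiff hf; apply/smooth_on_ndiff => k; exact: ndiffZ. Qed.

Lemma smooth_onN f : smooth_on U f -> smooth_on U (fun x => - f x).
Proof.
move=> /(smooth_onZ (-1)); apply: smooth_on_ext => y _; exact: scaleN1r.
Qed.

Lemma smooth_onB f g : smooth_on U f -> smooth_on U g ->
  smooth_on U (fun x => f x - g x).
Proof. by move=> sf sg; exact/smooth_onD/smooth_onN. Qed.

Lemma smooth_on_sum I (r : seq I) (P : pred I) (f : I -> V -> W) :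
  (forall i, smooth_on U (f i)) -> smooth_on U (fun x => \sum_(i <- r | P i) f i x).
Proof.
move=> sf; elim: r => [|i r IH].
  by under eq_fun do rewrite big_nil; exact: smooth_on_cst.
under eq_fun do rewrite big_cons; case: (P i) => //.
exact: smooth_onD.
Qed.

End Closure.

Lemma smooth_on_subset U U' f : U' `<=` U -> smooth_on U f -> smooth_on U' f.
Proof. by move=> UU' sf s x /UU'; exact: sf. Qed.

End SmoothGeneric.

Section SmoothScalar.
Context {R : realType} {V : normedModType R}.
Variable U : set V.
Hypothesis oU : open U.
Implicit Types f g : V -> R.

(** By Leibniz' rule the derivative is a sum of products in which one factor is differentiated;
    [ndiffW] lowers the order of the other one to match. *)
Lemma ndiffM k f g : ndiff k U f -> ndiff k U g -> ndiff k U (fun x => f x * g x).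
Proof.
elim: k f g => [|k IH] f g cf cg.
  split=> // x Ux; apply: differentiableM; [exact: ndiff_diff cf Ux|exact: ndiff_diff cg Ux].
split=> [x Ux|v].
  by apply: differentiableM; [exact: ndiff_diff cf Ux|exact: ndiff_diff cg Ux].
have [[df Df] [dg Dg]] := (cf, cg).
apply: ndiff_ext (ndiffD oU (IH _ _ (ndiffW cf) (Dg v)) (IH _ _ (ndiffW cg) (Df v))) => // y Uy.
by rewrite -deriveM//; [exact/diff_derivable/df|exact/diff_derivable/dg].
Qed.

Lemma ndiffV k f : (forall x, U x -> f x != 0) -> ndiff k U f -> ndiff k U (fun x => (f x)^-1).
Proof.
move=> f0; elim: k f f0 => [|k IH] f f0 cf.
  by split=> // x Ux; apply: differentiableV; [exact: ndiff_diff cf Ux|exact: f0].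
split=> [x Ux|v].
  by apply: differentiableV; [exact: ndiff_diff cf Ux|exact: f0].
have [df Df] := cf; have ci := IH _ f0 (ndiffW cf).
apply: ndiff_ext (ndiffZ (-1) oU (ndiffM (ndiffM ci ci) (Df v))) => // y Uy.
rewrite deriveV; [|exact: f0|exact/diff_derivable/df].
by rewrite scaleN1r -mulNr -exprVn expr2.
Qed.

Lemma smooth_onM f g : smooth_on U f -> smooth_on U g ->
  smooth_on U (fun x => f x * g x).
Proof.
by move=> /smooth_on_ndiff hf /smooth_on_ndiff hg; apply/smooth_on_ndiff => k; exact: ndiffM.
Qed.

Lemma smooth_onV f : (forall x, U x -> f x != 0) -> smooth_on U f ->
  smooth_on U (fun x => (f x)^-1).
Proof. by move=> f0 /smooth_on_ndiff hf; apply/smooth_on_ndiff => k; exact: ndiffV. Qed.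

Lemma smooth_on_prod I (r : seq I) (f : I -> V -> R) :
  (forall i, smooth_on U (f i)) -> smooth_on U (fun x => \prod_(i <- r) f i x).
Proof.
move=> sf; elim: r => [|i r IH].
  by under eq_fun do rewrite big_nil; exact: smooth_on_cst.
by under eq_fun do rewrite big_cons; exact: smooth_onM.
Qed.

End SmoothScalar.

(** * Smooth matrix-valued functions *)

Section SmoothMatrix.
Context {R : realType} {V : normedModType R}.
Variable U : set V.
Hypothesis oU : open U.

Lemma differentiable_mx m n (f : V -> 'M[R]_(m, n)) x :
  (forall i j, differentiable (fun y => f y i j) x) -> differentiable f x.
Proof.
move=> df.
have -> : f = \sum_i \sum_j (fun y => f y i j *: (delta_mx i j : 'M[R]_(m, n))).
  apply/funext => y; rewrite fct_sumE [LHS]matrix_sum_delta.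
  by apply: eq_bigr => i _; rewrite fct_sumE.
by do 2!(apply: differentiable_sum => ?); exact: differentiableZl.
Qed.

Lemma derive_entry m n (f : V -> 'M[R]_(m, n)) x v i j : differentiable f x ->
  'D_v f x i j = 'D_v (fun y => f y i j) x.
Proof. by move=> df; rewrite derive_mx ?mxE //; exact: diff_derivable. Qed.

Lemma differentiable_entry m n (f : V -> 'M[R]_(m, n)) x i j :
  differentiable f x -> differentiable (fun y => f y i j) x.
Proof.
by move=> df; exact: (@differentiable_comp _ _ _ _ f (fun N : 'M[R]_(m, n) => N i j)
  x df (differentiable_coord _ _ _)).
Qed.

Lemma ndiff_mx k m n (f : V -> 'M[R]_(m, n)) :
  ndiff k U f <-> forall i j, ndiff k U (fun x => f x i j).
Proof.
split.
  elim: k f => [|k IH] f [df Df] i j.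
    by split=> // x Ux; exact/differentiable_entry/df.
  split=> [x Ux|v]; first exact/differentiable_entry/df.
  apply: ndiff_ext (IH _ (Df v) i j) => // y Uy.
  exact/derive_entry/df.
elim: k f => [|k IH] f cf.
  by split=> // x Ux; apply: differentiable_mx => i j; exact: ndiff_diff (cf i j) Ux.
have df x : U x -> differentiable f x.
  by move=> Ux; apply: differentiable_mx => i j; exact: ndiff_diff (cf i j) Ux.
split=> // v; apply: IH => i j.
have [_ /(_ v)] := cf i j; apply: ndiff_ext => // y Uy.
by rewrite derive_entry//; exact: df.
Qed.

Lemma smooth_on_mx m n (f : V -> 'M[R]_(m, n)) :
  smooth_on U f <-> forall i j, smooth_on U (fun x => f x i j).
Proof.
split=> [/smooth_on_ndiff h i j|h]; apply/smooth_on_ndiff => k.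
  exact: (ndiff_mx _ _).1 (h k) i j.
by apply/ndiff_mx => i j; exact: (smooth_on_ndiff _ _).1 (h i j) k.
Qed.

Lemma smooth_on_mulmx m n p (f : V -> 'M[R]_(m, n)) (g : V -> 'M[R]_(n, p)) :
  smooth_on U f -> smooth_on U g -> smooth_on U (fun x => f x *m g x).
Proof.
move=> /smooth_on_mx sf /smooth_on_mx sg; apply/smooth_on_mx => i j.
under eq_fun do rewrite mxE.
by apply: smooth_on_sum => // k; exact: smooth_onM.
Qed.

Lemma smooth_on_tr m n (f : V -> 'M[R]_(m, n)) :
  smooth_on U f -> smooth_on U (fun x => (f x)^T).
Proof.
move=> /smooth_on_mx sf; apply/smooth_on_mx => i j.
by under eq_fun do rewrite mxE; exact: sf.
Qed.

Lemma smooth_on_scale m n (f : V -> R) (g : V -> 'M[R]_(m, n)) :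
  smooth_on U f -> smooth_on U g -> smooth_on U (fun x => f x *: g x).
Proof.
move=> sf /smooth_on_mx sg; apply/smooth_on_mx => i j.
by under eq_fun do rewrite mxE; exact: smooth_onM.
Qed.

Lemma smooth_on_det n (f : V -> 'M[R]_n) :
  smooth_on U f -> smooth_on U (fun x => \det (f x)).
Proof.
move=> /smooth_on_mx sf; apply: smooth_on_sum => // s.
by apply: smooth_onM => //; [exact: smooth_on_cst|exact: smooth_on_prod].
Qed.

(** Cramer's rule: the entries of the inverse are polynomials in the entries of [f x], divided by a
    determinant without zeros on [U]. *)
Lemma smooth_on_invmx n (f : V -> 'M[R]_n) : (forall x, U x -> f x \in unitmx) ->
  smooth_on U f -> smooth_on U (fun x => invmx (f x)).
Proof.
move=> uf sf.
apply: (@smooth_on_ext _ _ _ _ oU (fun x => (\det (f x))^-1 *: \adj (f x))).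
  by move=> y Uy; rewrite /invmx uf.
apply: smooth_on_scale.
  apply: smooth_onV => //; last exact: smooth_on_det.
  by move=> x /uf; rewrite unitmxE unitfE.
apply/smooth_on_mx => i j; under eq_fun do rewrite mxE.
apply: smooth_onM => //; first exact: smooth_on_cst.
apply: smooth_on_det; apply/smooth_on_mx => k l.
under eq_fun do rewrite !mxE.
exact: (smooth_on_mx _).1.
Qed.

Lemma differentiable_mulmx m n p (f : V -> 'M[R]_(m, n)) (g : V -> 'M[R]_(n, p)) x :
  differentiable f x -> differentiable g x -> differentiable (fun y => f y *m g y) x.
Proof.
move=> df dg; apply: differentiable_mx => i j.
have -> : (fun y => (f y *m g y) i j) =
    \sum_k ((fun y => f y i k) * (fun y => g y k j)).
  by apply/funext => y; rewrite mxE fct_sumE.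
by apply: differentiable_sum => k; apply: differentiableM; exact: differentiable_entry.
Qed.

Lemma differentiable_tr m n (f : V -> 'M[R]_(m, n)) x :
  differentiable f x -> differentiable (fun y => (f y)^T) x.
Proof.
move=> df; apply: differentiable_mx => i j; under eq_fun do rewrite mxE.
exact: differentiable_entry.
Qed.

Lemma derive_mulmx m n p (f : V -> 'M[R]_(m, n)) (g : V -> 'M[R]_(n, p)) x v :
  differentiable f x -> differentiable g x ->
  'D_v (fun y => f y *m g y) x = 'D_v f x *m g x + f x *m 'D_v g x.
Proof.
move=> df dg.
have E i j : (fun y => (f y *m g y) i j) =
    \sum_k ((fun y => f y i k) * (fun y => g y k j)).
  by apply/funext => y; rewrite mxE fct_sumE.
apply/matrixP => i j.
rewrite (derive_entry _ _ _ (differentiable_mulmx df dg)) E derive_sum; last first.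
  move=> k; apply: diff_derivable.
  by apply: differentiableM; exact: differentiable_entry.
rewrite !mxE -big_split; apply: eq_bigr => k _ /=.
rewrite deriveM; try exact/diff_derivable/differentiable_entry.
rewrite (derive_entry _ _ _ df) (derive_entry _ _ _ dg) addrC; congr (_ + _).
exact: mulrC.
Qed.

Lemma derive_tr m n (f : V -> 'M[R]_(m, n)) x v : differentiable f x ->
  'D_v (fun y => (f y)^T) x = ('D_v f x)^T.
Proof.
move=> df; apply/matrixP => i j.
rewrite mxE (derive_entry _ _ _ df) (derive_entry _ _ _ (differentiable_tr df)).
by congr ('D_v _ x); apply/funext => y; rewrite mxE.
Qed.

End SmoothMatrix.

(** * Chain rule and symmetry of second derivatives *)

Section Derivatives.
Context {R : realType}.

Lemma derive_comp (U V W : normedModType R) (F : U -> V) (g : V -> W) x v :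
  differentiable F x -> differentiable g (F x) ->
  'D_v (fun y => g (F y)) x = 'D_('D_v F x) g (F x).
Proof.
move=> dF dg; have dgF := differentiable_comp dF dg.
by rewrite !deriveE // (diff_comp dF dg).
Qed.

Lemma derive_dir_lin (V W : normedModType R) (f : V -> W) x (a : R) v w :
  differentiable f x -> 'D_(a *: v + w) f x = a *: 'D_v f x + 'D_w f x.
Proof. by move=> df; rewrite !deriveE // linearP. Qed.

Lemma derive_row (m : nat) (W : normedModType R) (f : 'rV[R]_m -> W) x v :
  differentiable f x -> 'D_v f x = \sum_k v 0 k *: 'D_(delta_mx 0 k) f x.
Proof.
move=> df; rewrite deriveE // {1}(row_sum_delta v) linear_sum.
by apply: eq_bigr => k _; rewrite linearZ deriveE.
Qed.

(** The moving direction in the chain rule is expanded in the coordinate basis, so that [g] is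
    differentiated in fixed directions and the induction hypothesis applies to its derivatives. *)
Lemma ndiff_comp (V : normedModType R) m (U : set V) (U' : set 'rV[R]_m)
    (F : V -> 'rV[R]_m) (g : 'rV[R]_m -> R) k :
  open U -> open U' -> (forall x, U x -> U' (F x)) ->
  ndiff k U F -> ndiff k U' g -> ndiff k U (fun x => g (F x)).
Proof.
move=> oU oU' FU; elim: k g => [|k IH] g cF cg.
  split=> // x Ux.
  exact: differentiable_comp (ndiff_diff cF Ux) (ndiff_diff cg (FU _ Ux)).
split=> [x Ux|v].
  exact: differentiable_comp (ndiff_diff cF Ux) (ndiff_diff cg (FU _ Ux)).
have [[_ DF] [_ Dg]] := (cF, cg).
apply: (@ndiff_ext _ _ _ _ _
    (fun y => \sum_k ('D_v F y) 0 k * 'D_(delta_mx 0 k) g (F y))) => //.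
  move=> y Uy; have Uy' := FU _ Uy.
  rewrite (derive_comp _ (ndiff_diff cF Uy) (ndiff_diff cg Uy')).
  by rewrite (derive_row _ (ndiff_diff cg Uy')).
elim: (index_enum _) => [|i r IHr].
  by under eq_fun do rewrite big_nil; exact: ndiff_cst.
under eq_fun do rewrite big_cons; apply: ndiffD => //.
by apply: ndiffM => //; [exact: (ndiff_mx oU _ _).1 (DF v) 0 i|exact: IH (ndiffW cF) (Dg _)].
Qed.

Lemma smooth_on_comp (V : normedModType R) m p q (U : set V) (U' : set 'rV[R]_m)
    (F : V -> 'rV[R]_m) (g : 'rV[R]_m -> 'M[R]_(p, q)) :
  open U -> open U' -> (forall x, U x -> U' (F x)) ->
  smooth_on U F -> smooth_on U' g -> smooth_on U (fun x => g (F x)).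
Proof.
move=> oU oU' FU /smooth_on_ndiff sF /(smooth_on_mx oU') sg.
apply/(smooth_on_mx oU) => i j; apply/smooth_on_ndiff => k.
apply: (@ndiff_comp _ _ _ U' F (fun y => g y i j)) => //.
exact: (smooth_on_ndiff _ _).1 (sg i j) k.
Qed.

Section Schwarz.
Context {V : normedModType R}.
Implicit Types (f g : V -> R) (x v w : V).

Lemma mean_value_line g x v t : 0 < t ->
  (forall s, 0 <= s <= t -> differentiable g (x + s *: v)) ->
  exists2 s, 0 < s < t & g (x + t *: v) - g x = t * 'D_v g (x + s *: v).
Proof.
move=> t0 dg; pose l (s : R) : V := x + s *: v.
have dl s : differentiable l s.
  apply: differentiableD; first exact: differentiable_cst.
  exact: differentiableZl.
have Dl s : 'D_1 l s = v.
  rewrite deriveD; [|exact: derivable_cst|exact/diff_derivable/differentiableZl].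
  rewrite derive_cst add0r deriveE; last exact: differentiableZl.
  rewrite diffZl; last by [].
  by rewrite diff_val scale1r.
have dgl s : 0 <= s <= t -> differentiable (g \o l) s.
  by move=> st; apply: differentiable_comp => //; exact: dg.
have [||s] := @MVT R (g \o l) (fun s => 'D_v g (l s)) 0 t t0.
- move=> s; rewrite in_itv /= => /andP[s0 st].
  have st' : 0 <= s <= t by rewrite !ltW.
  apply: DeriveDef; first exact/diff_derivable/dgl.
  by rewrite derive_comp ?Dl //; exact: dg.
- apply: derivable_within_continuous => s; rewrite in_itv /= => st.
  exact/diff_derivable/dgl.
rewrite in_itv /= => st; rewrite /l /= scale0r addr0 subr0 => ->.
by exists s => //; rewrite mulrC.
Qed.

(** The second difference of [f] is a value of a mixed derivative at a nearby
    point, for either order of the directions; hence Schwarz's theorem. *)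
Lemma second_difference f (U : set V) x v w t : 0 < t -> smooth_on U f ->
  (forall s r, 0 <= s <= t -> 0 <= r <= t -> U (x + s *: v + r *: w)) ->
  exists s r, [/\ 0 < s < t, 0 < r < t &
    f (x + t *: v + t *: w) - f (x + t *: v) - (f (x + t *: w) - f x) =
    t * (t * 'D_w (fun y => 'D_v f y) (x + s *: v + r *: w))].
Proof.
move=> t0 sf xU; have tt : 0 <= t <= t by rewrite lexx ltW.
have t00 : (0 : R) <= 0 <= t by rewrite lexx ltW.
pose g y := f (y + t *: w) - f y.
have dsh y : U (y + t *: w) -> differentiable (fun y => f (y + t *: w)) y.
  move=> Uy; apply: (@differentiable_comp _ _ _ _ (fun y => y + t *: w)).
    by apply: differentiableD; [by []|exact: differentiable_cst].
  exact: smooth_on_diff Uy.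
have Ug s : 0 <= s <= t -> U (x + s *: v) /\ U (x + s *: v + t *: w).
  by move=> st; split; [rewrite -[_ + _]addr0 -(scale0r w); exact: xU|exact: xU].
have dg s : 0 <= s <= t -> differentiable g (x + s *: v).
  move=> /Ug[U1 U2]; apply: differentiableB; first exact: dsh.
  exact: smooth_on_diff U1.
have [s /andP[s0 st] E] := mean_value_line t0 dg.
have st' : 0 <= s <= t by rewrite !ltW.
have [U1 U2] := Ug _ st'.
have sDf := smooth_on_derive v sf.
have [r rt E2] := @mean_value_line (fun y => 'D_v f y) (x + s *: v) w t t0
  (fun r rt => smooth_on_diff sDf (xU s r st' rt)).
exists s, r; split=> //; first exact/andP.
rewrite -E2.
have -> : f (x + t *: v + t *: w) - f (x + t *: v) - (f (x + t *: w) - f x) =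
    g (x + t *: v) - g x by [].
rewrite E; congr (_ * _).
rewrite deriveB; [|exact/diff_derivable/dsh|exact: diff_derivable (smooth_on_diff sf U1)].
congr (_ + _).
rewrite (@derive_comp _ _ _ (fun y => y + t *: w)); last first.
- exact: smooth_on_diff U2.
- by apply: differentiableD; [by []|exact: differentiable_cst].
rewrite deriveD; [|exact: derivable_id|exact: derivable_cst].
by rewrite derive_id derive_cst addr0.
Qed.

Lemma normB_lt_split (a b c e : R) :
  `|a - c| < e / 2 -> `|b - c| < e / 2 -> `|a - b| < e.
Proof.
by move=> ac bc; rewrite [ltRHS]splitr -(subrKA c) -[c - b]opprB
  (le_lt_trans (ler_normB _ _))// ltrD.
Qed.

Lemma derive_swap_real f (U : set V) x v w : open U -> U x -> smooth_on U f ->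
  'D_v (fun y => 'D_w f y) x = 'D_w (fun y => 'D_v f y) x.
Proof.
move=> oU Ux sf.
pose g1 y := 'D_v (fun y => 'D_w f y) y.
pose g2 y := 'D_w (fun y => 'D_v f y) y.
have cg g : smooth_on U g -> {for x, continuous g}.
  by move=> sg; apply: differentiable_continuous; exact: smooth_on_diff sg Ux.
have /cvgrPdist_lt c1 : {for x, continuous g1} by exact/cg/smooth_on_derive/smooth_on_derive.
have /cvgrPdist_lt c2 : {for x, continuous g2} by exact/cg/smooth_on_derive/smooth_on_derive.
apply/eqP; rewrite -subr_eq0 -normr_le0; apply/ler_addgt0Pr => e e0; rewrite add0r.
have e2 : 0 < e / 2 by rewrite divr_gt0.
have : \forall y \near x, [/\ U y, `|g1 x - g1 y| < e / 2 & `|g2 x - g2 y| < e / 2].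
  have nU : nbhs x U by exact: open_nbhs_nbhs.
  have {}c1 := c1 _ e2.
  have {}c2 := c2 _ e2.
  move: nU c1 c2.
  by apply: filterS3 => y Uy h1 h2; split; [exact: Uy|exact: h1|exact: h2].
move=> /nbhs_ballP[d /= d0 dP].
(* For [s, r <= t] this gives [s |v| + r |w| <= t (|v| + |w|) < d], so the whole parallelogram lies
   in the ball; the [+ 1] makes the inequality strict and covers [v = w = 0]. *)
pose t := d / (`|v| + `|w| + 1).
have k0 : 0 < `|v| + `|w| + 1 by rewrite ltr_wpDl // addr_ge0.
have t0 : 0 < t by rewrite divr_gt0.
have inb s r : 0 <= s <= t -> 0 <= r <= t -> ball x d (x + s *: v + r *: w).
  move=> /andP[s0 st] /andP[r0 rt].
  rewrite -ball_normE /ball_/= -addrA opprD addrA subrr sub0r normrN.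
  rewrite (le_lt_trans (ler_normD _ _)) // !normrZ !ger0_norm //.
  have -> : d = t * (`|v| + `|w| + 1) by rewrite /t divfK // gt_eqF.
  have : s * `|v| <= t * `|v| by rewrite ler_wpM2r.
  have : r * `|w| <= t * `|w| by rewrite ler_wpM2r.
  by move: t0; lra.
have [s [r [/andP[s0 st] /andP[r0 rt] E2]]] := @second_difference f U x v w t t0 sf
  (fun s r hs hr => let: And3 a _ _ := dP _ (inb s r hs hr) in a).
have [r' [s' [/andP[r0' rt'] /andP[s0' st'] E1]]] := @second_difference f U x w v t t0 sf
  (fun s r hs hr => let: And3 a _ _ := dP _
     (eq_ind _ (ball x d) (inb r s hr hs) _ (addrAC _ _ _)) in a).
have [//||_ _ b2] := dP _ (inb s r _ _); rewrite ?ltW //.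
have [//||_ b1 _] := dP _ (inb s' r' _ _); rewrite ?ltW //.
(* The second difference is symmetric in [v] and [w]: dividing it twice by [t] gives a common value
   of the two mixed derivatives, taken at two points of the ball. *)
have {E1 E2} E : g2 (x + s *: v + r *: w) = g1 (x + s' *: v + r' *: w).
  apply: (mulfI (lt0r_neq0 t0)); apply: (mulfI (lt0r_neq0 t0)).
  rewrite -[LHS]E2 [x + s' *: v + _]addrAC -[RHS]E1 [x + t *: w + _]addrAC.
  move: (f (x + t *: v + t *: w)) (f (x + t *: v)) (f (x + t *: w)) (f x).
  by move=> p1 p2 p3 p4; ring.
by rewrite E in b2; exact: (normB_lt_split b1 b2).
Qed.

Lemma derive_swap m n (f : V -> 'M[R]_(m, n)) (U : set V) x v w :
  open U -> U x -> smooth_on U f ->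
  'D_v (fun y => 'D_w f y) x = 'D_w (fun y => 'D_v f y) x.
Proof.
move=> oU Ux sf; apply/matrixP => i j.
have E a b : 'D_a (fun y => 'D_b f y) x i j =
    'D_a (fun y => 'D_b (fun y => f y i j) y) x.
  have sD := smooth_on_derive b sf.
  rewrite (derive_entry _ _ _ (smooth_on_diff sD Ux)).
  apply: (derive_ext _ oU Ux) => y Uy.
  exact: derive_entry (smooth_on_diff sf Uy).
have sfij := (smooth_on_mx oU f).1 sf i j.
transitivity ('D_v (fun y => 'D_w (fun y => f y i j) y) x); first exact: E.
transitivity ('D_w (fun y => 'D_v (fun y => f y i j) y) x); last exact/esym/E.
exact: derive_swap_real oU Ux sfij.
Qed.

End Schwarz.
End Derivatives.

(** * Connections along a map *)

Section InnerProduct.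
Context {R : realType} {m : nat}.
Implicit Types (G : 'M[R]_m) (v w : 'rV[R]_m).

Lemma ipE G v w : ip G v w = \sum_i \sum_j v 0 i * G i j * w 0 j.
Proof.
rewrite /ip mxE exchange_big /=; apply: eq_bigr => j _.
by rewrite !mxE big_distrl.
Qed.

Lemma ipDl G v v' w : ip G (v + v') w = ip G v w + ip G v' w.
Proof. by rewrite /ip !mulmxDl mxE. Qed.
Lemma ipDr G v w w' : ip G v (w + w') = ip G v w + ip G v w'.
Proof. by rewrite /ip linearD mulmxDr mxE. Qed.
Lemma ipZl G a v w : ip G (a *: v) w = a * ip G v w.
Proof. by rewrite /ip -!scalemxAl mxE. Qed.
Lemma ipZr G a v w : ip G v (a *: w) = a * ip G v w.
Proof. by rewrite /ip linearZ -scalemxAr mxE. Qed.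
Lemma ipNl G v w : ip G (- v) w = - ip G v w.
Proof. by rewrite -scaleN1r ipZl mulN1r. Qed.
Lemma ipNr G v w : ip G v (- w) = - ip G v w.
Proof. by rewrite -scaleN1r ipZr mulN1r. Qed.
Lemma ipBl G v v' w : ip G (v - v') w = ip G v w - ip G v' w.
Proof. by rewrite ipDl ipNl. Qed.
Lemma ipBr G v w w' : ip G v (w - w') = ip G v w - ip G v w'.
Proof. by rewrite ipDr ipNr. Qed.
Lemma ip0l G w : ip G 0 w = 0.
Proof. by rewrite -(scale0r 0) ipZl mul0r. Qed.
Lemma ip0r G w : ip G w 0 = 0.
Proof. by rewrite -(scale0r 0) ipZr mul0r. Qed.
Lemma ip_suml G I (r : seq I) (P : pred I) (f : I -> 'rV[R]_m) w :
  ip G (\sum_(i <- r | P i) f i) w = \sum_(i <- r | P i) ip G (f i) w.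
Proof.
elim/big_rec2: _ => [|i a b _ <-]; first by rewrite ip0l.
by rewrite ipDl.
Qed.
Lemma ip_sumr G I (r : seq I) (P : pred I) (f : I -> 'rV[R]_m) w :
  ip G w (\sum_(i <- r | P i) f i) = \sum_(i <- r | P i) ip G w (f i).
Proof.
elim/big_rec2: _ => [|i a b _ <-]; first by rewrite ip0r.
by rewrite ipDr.
Qed.
Lemma ip_linG a G G' v w : ip (a *: G + G') v w = a * ip G v w + ip G' v w.
Proof. by rewrite /ip mulmxDr mulmxDl -scalemxAr -scalemxAl !mxE. Qed.
Lemma ip_tr G v w : ip G^T v w = ip G w v.
Proof.
by rewrite /ip -{1}(trmxK v) -mulmxA -!trmx_mul mxE ?mulmxA.
Qed.
Lemma ip_sym G v w : G^T = G -> ip G v w = ip G w v.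
Proof. by move=> GT; rewrite -{1}GT ip_tr. Qed.
Lemma ip_delta G i j : ip G (delta_mx 0 i) (delta_mx 0 j) = G i j.
Proof. by rewrite /ip -rowE trmx_delta -colE !mxE. Qed.

Definition posdef G := G^T = G /\ forall v, v != 0 -> 0 < ip G v v.

Lemma posdef_unit G : posdef G -> G \in unitmx.
Proof.
move=> [_ Gp]; rewrite -row_free_unit; apply/inj_row_free => v vG.
by apply/eqP; apply: contraT => /Gp; rewrite /ip vG mul0mx mxE ltxx.
Qed.

Lemma ip_nondeg G v : G \in unitmx -> (forall l, ip G v (delta_mx 0 l) = 0) -> v = 0.
Proof.
move=> uG h; rewrite -(mulmxK uG v); suff -> : v *m G = 0 by rewrite mul0mx.
apply/rowP => l; have := h l; rewrite /ip trmx_delta -colE mxE => ->.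
by rewrite mxE.
Qed.

Lemma ip_inj G v w : posdef G -> (forall z, ip G v z = ip G w z) -> v = w.
Proof.
move=> /posdef_unit uG h; apply/eqP; rewrite -subr_eq0; apply/eqP.
by apply: ip_nondeg uG _ => l; rewrite ipBl h subrr.
Qed.

Lemma ip_row G v (z : 'rV[R]_m) : ip G v z = \sum_l z 0 l * ip G v (delta_mx 0 l).
Proof. by rewrite {1}(row_sum_delta z) ip_sumr; apply: eq_bigr => l _; rewrite ipZr. Qed.

End InnerProduct.

Section DeriveIp.
Context {R : realType} {V : normedModType R} {m : nat}.

Lemma derive_ip (G : V -> 'M[R]_m) (A B : V -> 'rV[R]_m) u v :
  differentiable G u -> differentiable A u -> differentiable B u ->
  'D_v (fun u => ip (G u) (A u) (B u)) u =
  ip (G u) ('D_v A u) (B u) + ip (G u) (A u) ('D_v B u) + ip ('D_v G u) (A u) (B u).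
Proof.
move=> dG dA dB; rewrite /ip.
have dT := differentiable_tr dB; have dAG := differentiable_mulmx dA dG.
rewrite -(derive_entry _ _ _ (differentiable_mulmx dAG dT)).
rewrite (derive_mulmx _ dAG dT) (derive_mulmx _ dA dG) (derive_tr _ dB).
by rewrite mulmxDl !mxE addrAC.
Qed.

Lemma smooth_on_ip (U : set V) (G : V -> 'M[R]_m) (A B : V -> 'rV[R]_m) : open U ->
  smooth_on U G -> smooth_on U A -> smooth_on U B ->
  smooth_on U (fun u => ip (G u) (A u) (B u)).
Proof.
move=> oU sG sA sB; apply: (smooth_on_mx oU _).1.
by apply: smooth_on_mulmx => //; [exact: smooth_on_mulmx|exact: smooth_on_tr].
Qed.

End DeriveIp.

Lemma derive_ip_comp {R : realType} {V : normedModType R} {m q : nat}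
  (G : 'rV[R]_q -> 'M[R]_m) (F : V -> 'rV[R]_q) (A B : V -> 'rV[R]_m) u v :
  differentiable F u -> differentiable G (F u) ->
  differentiable A u -> differentiable B u ->
  'D_v (fun u => ip (G (F u)) (A u) (B u)) u =
  ip (G (F u)) ('D_v A u) (B u) + ip (G (F u)) (A u) ('D_v B u)
  + ip ('D_('D_v F u) G (F u)) (A u) (B u).
Proof.
move=> dF dG dA dB.
have dGF : differentiable (fun u => G (F u)) u := differentiable_comp dF dG.
by rewrite (derive_ip v dGF dA dB) (derive_comp v dF dG).
Qed.

Lemma derive_ip_cst {R : realType} {V : normedModType R} {m : nat}
  (G : V -> 'M[R]_m) (a b : 'rV[R]_m) u v : differentiable G u ->
  'D_v (fun u => ip (G u) a b) u = ip ('D_v G u) a b.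
Proof.
move=> dG.
rewrite (derive_ip v dG (differentiable_cst a u) (differentiable_cst b u)).
by rewrite !derive_cst ip0l ip0r !add0r.
Qed.

(** * Christoffel symbols and Koszul formula *)

Section Christoffel.
Context {R : realType} {m : nat}.
Variables (U' : set 'rV[R]_m) (h : 'rV[R]_m -> 'M[R]_m).
Hypotheses (oU' : open U') (sh : smooth_on U' h) (hp : forall y, U' y -> posdef (h y)).
Implicit Types (y a b c z : 'rV[R]_m).

Local Notation Gam := (christoffel_form h).

Let uh y : U' y -> h y \in unitmx. Proof. by move=> /hp/posdef_unit. Qed.
Let dh y : U' y -> differentiable h y. Proof. exact: smooth_on_diff. Qed.

Lemma derive_metric_sym y a : U' y -> ('D_a h y)^T = 'D_a h y.
Proof.
move=> Uy; rewrite -derive_tr; last exact: dh.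
by apply: (derive_ext _ oU' Uy) => x /hp[].
Qed.

(** Koszul formula for constant fields. Symmetry of the symbols, metric compatibility and the
    comparison with the induced connection are all read off from it. *)
Lemma christoffel_ip y a b z : U' y ->
  ip (h y) (Gam y a b) z =
  2^-1 * (ip ('D_a h y) b z + ip ('D_b h y) a z - ip ('D_z h y) a b).
Proof.
move=> Uy; have dhy := dh Uy.
(* The existential makes the directional derivative opaque; what remains is an identity of finite
   sums in a matrix [G] and a family of matrices [D]. *)
have [D DE] : exists D : 'rV[R]_m -> 'M[R]_m, forall c, D c = 'D_c h y.
  by exists (fun c => 'D_c h y).
have cE k i j : christoffel h y k i j = 2^-1 * \sum_l invmx (h y) k l *
    (D (delta_mx 0 i) j l + D (delta_mx 0 j) i l - D (delta_mx 0 l) i j).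
  congr (_ * _); apply: eq_bigr => l _; rewrite !DE; congr (_ * (_ + _ - _));
  exact/esym/derive_entry.
have sD c x x' : ip (D c) x x' = \sum_i c 0 i * ip (D (delta_mx 0 i)) x x'.
  rewrite DE (derive_row _ dhy); elim/big_rec2: _ => [|i s s' _ <-].
    by rewrite /ip mulmx0 mul0mx mxE.
  by rewrite ip_linG DE.
rewrite -!DE; have := posdef_unit (hp Uy); have := (hp Uy).1.
have -> : Gam y a b = \row_k \sum_i \sum_j (2^-1 * \sum_l invmx (h y) k l *
    (D (delta_mx 0 i) j l + D (delta_mx 0 j) i l - D (delta_mx 0 l) i j))
    * a 0 i * b 0 j.
  by apply/rowP => k; rewrite !mxE; do 2!(apply: eq_bigr => ? _); rewrite cE.
clear DE cE dhy; move: (h y) => G GT uG.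
(* Twice the symbol with its upper index lowered; pairing with [G] undoes the multiplication by
   [invmx G] that raised it. *)
pose t l := ip (D a) b (delta_mx 0 l) + ip (D b) a (delta_mx 0 l)
            - ip (D (delta_mx 0 l)) a b.
have ipd (G' : 'M[R]_m) x l : ip G' x (delta_mx 0 l) = \sum_j x 0 j * G' j l.
  by rewrite {1}(row_sum_delta x) ip_suml; apply: eq_bigr => j _; rewrite ipZl ip_delta.
have tE l : t l = \sum_i \sum_j (D (delta_mx 0 i) j l
     + D (delta_mx 0 j) i l - D (delta_mx 0 l) i j) * a 0 i * b 0 j.
  rewrite /t (sD a) (sD b) ipE.
  under eq_bigr do rewrite ipd mulr_sumr.
  under [X in _ + X - _]eq_bigr do rewrite ipd mulr_sumr.
  rewrite [X in _ + X - _]exchange_big /= -big_split -sumrB; apply: eq_bigr => i _ /=.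
  by rewrite -big_split -sumrB; apply: eq_bigr => j _ /=; ring.
have -> : (\row_k \sum_i \sum_j (2^-1 * \sum_l invmx G k l *
    (D (delta_mx 0 i) j l + D (delta_mx 0 j) i l - D (delta_mx 0 l) i j))
    * a 0 i * b 0 j) = 2^-1 *: ((\row_l t l) *m invmx G).
  apply/rowP => k; rewrite !mxE mulr_sumr.
  transitivity (\sum_i \sum_j \sum_l 2^-1 * invmx G k l * (D (delta_mx 0 i) j l
     + D (delta_mx 0 j) i l - D (delta_mx 0 l) i j) * a 0 i * b 0 j).
    apply: eq_bigr => i _; apply: eq_bigr => j _.
    by rewrite -mulrA mulr_sumr mulr_suml; apply: eq_bigr => l _; ring.
  under eq_bigr do rewrite exchange_big.
  rewrite exchange_big /=; apply: eq_bigr => l _.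
  rewrite mxE tE mulr_suml mulr_sumr; apply: eq_bigr => i _.
  rewrite mulr_suml mulr_sumr; apply: eq_bigr => j _.
  have -> : invmx G l k = invmx G k l by rewrite -[in RHS]GT -trmx_inv mxE.
  by ring.
rewrite ipZl; congr (_ * _).
rewrite {1}/ip mulmxKV // mxE; under eq_bigr do rewrite !mxE.
rewrite (ip_row _ b) (ip_row _ a) (sD z) -big_split -sumrB.
by apply: eq_bigr => l _ /=; rewrite /t; ring.
Qed.

(** Collecting the symbols with upper index [k] turns each component of [christoffel_form] into an
    [ip], which hands over bilinearity, smoothness and the product rule. *)
Definition chr_mx (k : 'I_m) y : 'M[R]_m := \matrix_(i, j) christoffel h y k i j.

Lemma chr_mxE k y a b : Gam y a b 0 k = ip (chr_mx k y) a b.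
Proof.
rewrite mxE ipE; apply: eq_bigr => i _; apply: eq_bigr => j _.
by rewrite mxE; ring.
Qed.

Lemma smooth_chr_mx k : smooth_on U' (chr_mx k).
Proof.
apply/(smooth_on_mx oU') => i j; under eq_fun do rewrite mxE.
rewrite /christoffel; apply: smooth_onM => //; first exact: smooth_on_cst.
apply: smooth_on_sum => // l; apply: smooth_onM => //.
  by apply: (smooth_on_mx oU' _).1; exact: smooth_on_invmx.
have sD p q r : smooth_on U' (fun y => 'D_(delta_mx 0 p) (fun w => h w q r) y).
  by apply: smooth_on_derive; exact: (smooth_on_mx oU' _).1.
by apply: smooth_onB => //; exact: smooth_onD.
Qed.

Lemma chr_formDl y a a' b : Gam y (a + a') b = Gam y a b + Gam y a' b.
Proof. by apply/rowP => k; rewrite [RHS]mxE !chr_mxE ipDl. Qed.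
Lemma chr_formDr y a b b' : Gam y a (b + b') = Gam y a b + Gam y a b'.
Proof. by apply/rowP => k; rewrite [RHS]mxE !chr_mxE ipDr. Qed.
Lemma chr_formZl y (c : R) a b : Gam y (c *: a) b = c *: Gam y a b.
Proof. by apply/rowP => k; rewrite [RHS]mxE !chr_mxE ipZl. Qed.
Lemma chr_formZr y (c : R) a b : Gam y a (c *: b) = c *: Gam y a b.
Proof. by apply/rowP => k; rewrite [RHS]mxE !chr_mxE ipZr. Qed.
Lemma chr_form0l y b : Gam y 0 b = 0.
Proof. by have := chr_formZl y 0 0 b; rewrite !scale0r. Qed.
Lemma chr_form0r y a : Gam y a 0 = 0.
Proof. by have := chr_formZr y 0 a 0; rewrite scaler0 scale0r. Qed.

Lemma chr_form_sym y a b : U' y -> Gam y a b = Gam y b a.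
Proof.
move=> Uy; apply: ip_inj (hp Uy) _ => z.
have := christoffel_ip b a z Uy; have := christoffel_ip a b z Uy.
have := derive_metric_sym z Uy.
move: ('D_a h y) ('D_b h y) ('D_z h y) => A B C /ip_sym CT -> ->.
by rewrite (CT b a) [X in _ * (X - _)]addrC.
Qed.

Lemma curvature_atE y a b z : U' y ->
  curvature_at h y a b z =
  'D_a (fun x => Gam x b z) y - 'D_b (fun x => Gam x a z) y
  + Gam y a (Gam y b z) - Gam y b (Gam y a z).
Proof.
move=> Uy; rewrite /curvature_at /curvature.
have E c : levi_civita h (cst c) (cst z) = fun x => Gam x c z.
  by apply/funext => x; rewrite /levi_civita /= derive_cst add0r.
have -> : levi_civita h (lie_bracket (cst a) (cst b)) (cst z) y = 0.
  rewrite /levi_civita derive_cst /lie_bracket !derive_cst subrr chr_form0l.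
  exact: addr0.
by rewrite !E subr0 /levi_civita /= opprD addrACA !addrA.
Qed.

End Christoffel.

(** Locked: otherwise unification compares derivatives in distinct directions by
    unfolding them to limits. *)
HB.lock Definition conn {R : realType} {p m : nat} (h : 'rV[R]_m -> 'M[R]_m)
    (F : 'rV[R]_p -> 'rV[R]_m) (v : 'rV[R]_p) (V : 'rV[R]_p -> 'rV[R]_m)
    (u : 'rV[R]_p) : 'rV[R]_m :=
  'D_v V u + christoffel_form h (F u) ('D_v F u) (V u).

HB.lock Definition push {R : realType} {p m : nat}
    (F : 'rV[R]_p -> 'rV[R]_m) (v u : 'rV[R]_p) : 'rV[R]_m := 'D_v F u.

(** * The pull-back connection: product rule, torsion, metric compatibility *)

Section Connection.
Context {R : realType} {p m : nat}.
Variables (U' : set 'rV[R]_m) (h : 'rV[R]_m -> 'M[R]_m).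
Hypotheses (oU' : open U') (sh : smooth_on U' h) (hp : forall y, U' y -> posdef (h y)).
Variables (U : set 'rV[R]_p) (F : 'rV[R]_p -> 'rV[R]_m).
Hypotheses (oU : open U) (sF : smooth_on U F) (FU : forall u, U u -> U' (F u)).
Implicit Types (u v w : 'rV[R]_p) (V W : 'rV[R]_p -> 'rV[R]_m).

Local Notation Gam := (christoffel_form h).
Local Notation D := (conn h F).

Let dF u : U u -> differentiable F u. Proof. exact: smooth_on_diff. Qed.

Lemma connE v V u : D v V u = 'D_v V u + Gam (F u) (push F v u) (V u).
Proof. by rewrite conn.unlock push.unlock. Qed.

Lemma conn0 v u : D v (fun=> 0) u = 0.
Proof. by rewrite connE chr_form0r addr0; exact: derive_cst. Qed.

Lemma smooth_push v : smooth_on U (push F v).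
Proof. by rewrite push.unlock; exact: smooth_on_derive. Qed.

Lemma smooth_christoffel_form_along (A B : 'rV[R]_p -> 'rV[R]_m) :
  smooth_on U A -> smooth_on U B ->
  smooth_on U (fun u => Gam (F u) (A u) (B u)).
Proof.
move=> sA sB; apply/(smooth_on_mx oU) => i k; rewrite ord1.
under eq_fun do rewrite chr_mxE.
apply: smooth_on_ip => //; apply: smooth_on_comp FU sF _ => //.
exact: smooth_chr_mx.
Qed.

Lemma smooth_conn v V : smooth_on U V -> smooth_on U (D v V).
Proof.
move=> sV; rewrite (_ : D v V = fun u => 'D_v V u + Gam (F u) (push F v u) (V u)).
  apply: smooth_onD => //; first exact: smooth_on_derive.
  by apply: smooth_christoffel_form_along => //; exact: smooth_push.
by apply/funext => u; rewrite connE.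
Qed.

Lemma conn_ext v V W u : U u -> (forall u, U u -> V u = W u) -> D v V u = D v W u.
Proof.
move=> Uu VW; rewrite (connE v V) (connE v W) (VW _ Uu).
exact: (congr2 +%R (derive_ext _ oU Uu VW)).
Qed.

Lemma connD v V W u : U u -> smooth_on U V -> smooth_on U W ->
  D v (fun u => V u + W u) u = D v V u + D v W u.
Proof.
move=> Uu sV sW; rewrite !connE chr_formDr addrACA; congr (_ + _).
by apply: deriveD; apply: diff_derivable; [exact: smooth_on_diff Uu|exact: smooth_on_diff Uu].
Qed.

Lemma connZ v (a : R) V u : U u -> smooth_on U V ->
  D v (fun u => a *: V u) u = a *: D v V u.
Proof.
move=> Uu sV; rewrite !connE chr_formZr scalerDr; congr (_ + _).
by apply: deriveZ; apply: diff_derivable; exact: smooth_on_diff Uu.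
Qed.

Lemma connN v V u : U u -> smooth_on U V -> D v (fun u => - V u) u = - D v V u.
Proof.
move=> Uu sV; rewrite -scaleN1r -connZ //.
by apply: conn_ext => // w _; rewrite scaleN1r.
Qed.

Lemma connB v V W u : U u -> smooth_on U V -> smooth_on U W ->
  D v (fun u => V u - W u) u = D v V u - D v W u.
Proof. by move=> Uu sV sW; rewrite connD ?connN //; exact: smooth_onN. Qed.

Lemma connM v (f : 'rV[R]_p -> R) V u : U u -> smooth_on U f -> smooth_on U V ->
  D v (fun u => f u *: V u) u = 'D_v f u *: V u + f u *: D v V u.
Proof.
move=> Uu sf sV; rewrite !connE chr_formZr scalerDr addrA; congr (_ + _).
have dV := smooth_on_diff sV Uu; have df := smooth_on_diff sf Uu.
apply/rowP => k; rewrite derive_entry; last exact: smooth_on_diff (smooth_on_scale oU sf sV) Uu.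
have -> : (fun y => (f y *: V y) 0 k) = (f * (fun y => V y 0 k)).
  by apply/funext => y; rewrite mxE.
rewrite deriveM; [|exact: diff_derivable|exact/diff_derivable/differentiable_entry].
rewrite -(derive_entry _ _ _ dV) !mxE addrC; congr (_ + _).
exact: mulrC.
Qed.

Lemma push_lin (a : R) v w u : U u -> push F (a *: v + w) u = a *: push F v u + push F w u.
Proof. by move=> Uu; rewrite push.unlock derive_dir_lin //; exact: dF. Qed.

Lemma conn_dir_lin (a : R) v w V u : U u -> smooth_on U V ->
  D (a *: v + w) V u = a *: D v V u + D w V u.
Proof.
move=> Uu sV; rewrite !connE push_lin // chr_formDl chr_formZl scalerDr addrACA.
congr (_ + _); apply: derive_dir_lin; exact: smooth_on_diff Uu.
Qed.

(** Absence of torsion along a map: second derivatives of [F] commute and the Christoffel symbols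
    are symmetric. *)
Lemma conn_push_sym v w u : U u -> D v (push F w) u = D w (push F v) u.
Proof.
move=> Uu; rewrite (connE v) (connE w).
have E : 'D_v (push F w) u = 'D_w (push F v) u.
  by rewrite push.unlock; exact: (derive_swap _ _ oU Uu sF).
exact: (congr2 +%R E (chr_form_sym oU' sh hp _ _ (FU Uu))).
Qed.

(** In the two Koszul formulas the derivatives of [h] along [V u] and [W u] cancel, while the two
    halves of its derivative along [push F v u] add up. *)
Lemma conn_ip v V W u : U u -> smooth_on U V -> smooth_on U W ->
  'D_v (fun u => ip (h (F u)) (V u) (W u)) u =
  ip (h (F u)) (D v V u) (W u) + ip (h (F u)) (V u) (D v W u).
Proof.
move=> Uu sV sW; have Uy := FU Uu.
have dV := smooth_on_diff sV Uu; have dW := smooth_on_diff sW Uu.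
rewrite (derive_ip_comp v (dF Uu) (smooth_on_diff sh Uy) dV dW) !connE ipDl ipDr.
rewrite addrACA; congr (_ + _).
rewrite [X in _ = _ + X](ip_sym _ _ (hp Uy).1).
have := christoffel_ip sh hp (push F v u) (W u) (V u) Uy.
have := christoffel_ip sh hp (push F v u) (V u) (W u) Uy.
have -> : 'D_('D_v F u) h (F u) = 'D_(push F v u) h (F u) by rewrite push.unlock.
have := derive_metric_sym oU' sh hp (push F v u) Uy.
move: ('D_(push F v u) h (F u)) ('D_(V u) h (F u)) ('D_(W u) h (F u)) (V u) (W u).
move=> A B C x y /ip_sym AT -> ->; rewrite (AT y x); lra.
Qed.

End Connection.

(** * Curvature of the pull-back connection *)

Section ConnectionCurvature.
Context {R : realType} {p m : nat}.
Variables (U' : set 'rV[R]_m) (h : 'rV[R]_m -> 'M[R]_m).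
Hypotheses (oU' : open U') (sh : smooth_on U' h) (hp : forall y, U' y -> posdef (h y)).
Variables (U : set 'rV[R]_p) (F : 'rV[R]_p -> 'rV[R]_m).
Hypotheses (oU : open U) (sF : smooth_on U F) (FU : forall u, U u -> U' (F u)).
Implicit Types (u v w : 'rV[R]_p) (V W : 'rV[R]_p -> 'rV[R]_m).

Local Notation Gam := (christoffel_form h).
Local Notation D := (conn h F).

Lemma smooth_christoffel_form a b : smooth_on U' (fun y => Gam y a b).
Proof.
apply/(smooth_on_mx oU') => i k; rewrite ord1.
under eq_fun do rewrite chr_mxE.
by apply: smooth_on_ip => //; [exact: smooth_chr_mx|exact: smooth_on_cst|exact: smooth_on_cst].
Qed.

Lemma derive_christoffel_form_along v (A B : 'rV[R]_p -> 'rV[R]_m) u : U u ->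
  smooth_on U A -> smooth_on U B ->
  'D_v (fun u => Gam (F u) (A u) (B u)) u =
  Gam (F u) ('D_v A u) (B u) + Gam (F u) (A u) ('D_v B u)
  + 'D_(push F v u) (fun y => Gam y (A u) (B u)) (F u).
Proof.
move=> Uu sA sB; have Uy := FU Uu.
have dG := smooth_on_diff (smooth_christoffel_form_along oU' sh hp oU sF FU sA sB) Uu.
have dG' := smooth_on_diff (smooth_christoffel_form (A u) (B u)) Uy.
apply/rowP => k.
have dc := smooth_on_diff (smooth_chr_mx oU' sh hp k) Uy.
rewrite (derive_entry _ _ _ dG) mxE [X in _ = X + _]mxE (derive_entry _ _ _ dG').
have -> : (fun y => Gam (F y) (A y) (B y) 0 k) =
  fun y => ip (chr_mx h k (F y)) (A y) (B y).
  by apply/funext => y; rewrite chr_mxE.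
have -> : (fun y => Gam y (A u) (B u) 0 k) = fun y => ip (chr_mx h k y) (A u) (B u).
  by apply/funext => y; rewrite chr_mxE.
rewrite (derive_ip_comp v (smooth_on_diff sF Uu) dc (smooth_on_diff sA Uu)
  (smooth_on_diff sB Uu)).
by rewrite (derive_ip_cst _ _ _ dc) push.unlock !chr_mxE.
Qed.

(** Constant directions have zero bracket. The second derivatives of [V] and of [F] cancel by
    Schwarz, and the remaining terms are the coordinate expression of the ambient curvature. With
    [F = id] this also shows that curvature may be computed on any field. *)
Lemma conn_commutator v w V u : U u -> smooth_on U V ->
  D v (D w V) u - D w (D v V) u =
  curvature_at h (F u) (push F v u) (push F w u) (V u).
Proof.
move=> Uu sV; have Uy := FU Uu.
have DD v' w' : D v' (D w' V) u =
  'D_v' (fun u => 'D_w' V u) u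
  + (Gam (F u) ('D_v' (push F w') u) (V u) + Gam (F u) (push F w' u) ('D_v' V u)
  + 'D_(push F v' u) (fun y => Gam y (push F w' u) (V u)) (F u))
  + Gam (F u) (push F v' u) ('D_w' V u + Gam (F u) (push F w' u) (V u)).
  rewrite (connE h F v') connE; congr (_ + _).
  have -> : D w' V = fun u => 'D_w' V u + Gam (F u) (push F w' u) (V u).
    by apply/funext => y; rewrite connE.
  rewrite deriveD.
  - by rewrite (derive_christoffel_form_along v' Uu (smooth_push sF w') sV).
  - exact: diff_derivable (smooth_on_diff (smooth_on_derive w' sV) Uu).
  - have sG := smooth_christoffel_form_along oU' sh hp oU sF FU (smooth_push sF w') sV.
    exact: diff_derivable (smooth_on_diff sG Uu).
rewrite (DD v w) (DD w v) (curvature_atE _ _ _ _ Uy).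
have -> : 'D_v (push F w) u = 'D_w (push F v) u.
  by rewrite push.unlock; exact: (derive_swap _ _ oU Uu sF).
have E : 'D_v (fun y => 'D_w V y) u = 'D_w (fun y => 'D_v V y) u.
  exact: derive_swap oU Uu sV.
rewrite E {E} !chr_formDr.
move: ('D_v _ u) ('D_w V u) ('D_(push F v u) _ _) ('D_(push F w u) _ _) => A B C E.
move: (Gam _ _ _) (Gam _ _ _) => G1 G2.
move: (Gam _ _ _) (Gam _ _ _) (Gam _ _ _) ('D_w _ _) => G3 G4 G5 G6.
by apply/rowP => i; rewrite !mxE; ring.
Qed.

Lemma conn_cst_sym (a b y : 'rV[R]_m) : U' y ->
  conn h id a (fun=> b) y = conn h id b (fun=> a) y.
Proof.
move=> Uy; rewrite !connE push.unlock !derive_id.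
have E x z : 'D_x (fun=> z : 'rV[R]_m) y = 0 by exact: derive_cst.
by rewrite !E (chr_form_sym oU' sh hp).
Qed.

End ConnectionCurvature.

Lemma levi_civitaE {R : realType} {m : nat} (h : 'rV[R]_m -> 'M[R]_m) X V u :
  levi_civita h X V u = conn h id (X u) V u.
Proof. by rewrite conn.unlock derive_id. Qed.

Lemma smooth_on_id {R : realType} {V : normedModType R} (U : set V) :
  smooth_on U (id : V -> V).
Proof.
apply/smooth_on_ndiff => -[|k]; split=> // v.
have -> : (fun x : V => 'D_v id x) = fun=> v by apply/funext => x; rewrite derive_id.
exact: ndiff_cst.
Qed.

(** * Symmetries of the curvature tensor *)

Section AmbientCurvature.
Context {R : realType} {m : nat}.
Variables (U' : set 'rV[R]_m) (h : 'rV[R]_m -> 'M[R]_m).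
Hypotheses (oU' : open U') (sh : smooth_on U' h) (hp : forall y, U' y -> posdef (h y)).
Implicit Types (a b c d z w : 'rV[R]_m).

Local Notation D := (conn h id).
Let sid : smooth_on U' (id : 'rV[R]_m -> 'rV[R]_m) := @smooth_on_id R _ U'.
Let idU (y : 'rV[R]_m) : U' y -> U' (id y). Proof. by []. Qed.
Let sc (a : 'rV[R]_m) : smooth_on U' (fun=> a). Proof. exact: smooth_on_cst. Qed.
Let sD a V : smooth_on U' V -> smooth_on U' (D a V).
Proof. exact: (smooth_conn oU' sh hp oU' sid idU). Qed.
Let sDc a b : smooth_on U' (D a (fun=> b)). Proof. exact/sD/sc. Qed.

Lemma curvature_field a b V y : U' y -> smooth_on U' V ->
  curvature_at h y a b (V y) = D a (D b V) y - D b (D a V) y.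
Proof.
move=> Uy sV; rewrite (conn_commutator oU' sh hp oU' sid idU a b Uy sV).
by rewrite push.unlock !derive_id.
Qed.

Lemma curvature_cst a b z y : U' y ->
  curvature_at h y a b z = D a (D b (fun=> z)) y - D b (D a (fun=> z)) y.
Proof. by move=> Uy; rewrite -(curvature_field a b Uy (sc z)). Qed.

Lemma curvature_antisym a b z y : U' y ->
  curvature_at h y a b z = - curvature_at h y b a z.
Proof. by move=> Uy; rewrite !curvature_cst // opprB. Qed.

(** On constant fields [D_a D_b c = D_a D_c b], which pairs off the six terms. *)
Lemma curvature_bianchi a b c y : U' y ->
  curvature_at h y a b c + curvature_at h y b c a + curvature_at h y c a b = 0.
Proof.
move=> Uy; rewrite !curvature_cst //.
have E a' b' c' : D a' (D b' (fun=> c')) y = D a' (D c' (fun=> b')) y.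
  apply: (conn_ext h id oU' a' Uy) => x Ux; exact: (conn_cst_sym oU' sh hp).
rewrite (E a b c) (E b c a) (E c a b).
move: (D _ _ y) (D _ _ y) (D _ _ y) => A B C.
by apply/rowP => i; rewrite !mxE; ring.
Qed.

Lemma curvature_lin1 (k : R) a a' b z y : U' y ->
  curvature_at h y (k *: a + a') b z =
  k *: curvature_at h y a b z + curvature_at h y a' b z.
Proof.
move=> Uy; rewrite !curvature_cst //.
rewrite (conn_dir_lin h sid k a a' Uy (sDc b z)).
have -> : D b (D (k *: a + a') (fun=> z)) y =
    k *: D b (D a (fun=> z)) y + D b (D a' (fun=> z)) y.
  transitivity (D b (fun x => k *: D a (fun=> z) x + D a' (fun=> z) x) y).
    apply: (conn_ext h id oU' b Uy) => x Ux.
    exact: (conn_dir_lin h sid k a a' Ux (sc z)).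
  rewrite (connD h id b Uy (smooth_onZ oU' k (sDc a z)) (sDc a' z)).
  by rewrite (connZ h id b k Uy (sDc a z)).
by apply/rowP => i; rewrite !mxE; ring.
Qed.

Lemma curvatureZr (k : R) a b z y : U' y ->
  curvature_at h y a (k *: b) z = k *: curvature_at h y a b z.
Proof.
move=> Uy; have z0 : curvature_at h y 0 a z = 0.
  have := curvature_lin1 1 0 0 a z Uy; rewrite scaler0 addr0 scale1r => /eqP.
  by rewrite -subr_eq0 opprD addrA subrr sub0r oppr_eq0 => /eqP.
rewrite curvature_antisym // -[k *: b]addr0 curvature_lin1 // z0 addr0 -scalerN.
by rewrite -curvature_antisym.
Qed.

(** Schwarz's theorem for the function [ip (h x) z w]: after two uses of metric compatibility the
    products of first derivatives are symmetric in [a], [b], and the second-order terms left over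
    are the claim. *)
Lemma curvature_skew a b z w y : U' y ->
  ip (h y) (curvature_at h y a b z) w = - ip (h y) (curvature_at h y a b w) z.
Proof.
move=> Uy.
have cip v V W x (Ux : U' x) := conn_ip oU' sh hp sid idU v Ux (V := V) (W := W).
have E a' b' : 'D_a' (fun x => 'D_b' (fun x => ip (h x) z w) x) y =
    ip (h y) (D a' (D b' (fun=> z)) y) w + ip (h y) (D b' (fun=> z) y) (D a' (fun=> w) y)
    + (ip (h y) (D a' (fun=> z) y) (D b' (fun=> w) y) + ip (h y) z (D a' (D b' (fun=> w)) y)).
  transitivity ('D_a' (fun x => ip (h x) (D b' (fun=> z) x) w + ip (h x) z (D b' (fun=> w) x)) y).
    by apply: (derive_ext _ oU' Uy) => x Ux; exact: cip.
  have d1 := smooth_on_diff (smooth_on_ip oU' sh (sDc b' z) (sc w)) Uy.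
  have d2 := smooth_on_diff (smooth_on_ip oU' sh (sc z) (sDc b' w)) Uy.
  rewrite deriveD; [|exact: diff_derivable d1|exact: diff_derivable d2].
  by rewrite (cip a' _ _ _ Uy (sDc b' z) (sc w)) (cip a' _ _ _ Uy (sc z) (sDc b' w)).
have := derive_swap_real a b oU' Uy (smooth_on_ip oU' sh (sc z) (sc w)).
rewrite (E a b) (E b a) !curvature_cst // !ipBl.
rewrite !(ip_sym _ z (hp Uy).1).
move: (ip _ _ _) (ip _ _ _) (ip _ _ _) (ip _ _ _) (ip _ _ _) (ip _ _ _).
by move=> *; lra.
Qed.

End AmbientCurvature.

(** * Curvature of Sasakian space forms *)

Section KaehlerAlgebra.
Context {R : realType} {V : lmodType R}.
Variables (D : V -> Prop) (J : V -> V).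
Hypotheses (DD : forall k x y, D x -> D y -> D (k *: x + y)) (DJ : forall x, D x -> D (J x))
  (JJ : forall x, D x -> J (J x) = - x).

(** The quartic [q a a a a] vanishes at [a = k *: x + y] for all [k]. Adding its values at [k = 1]
    and [k = -1] removes the odd powers and leaves twice the coefficient of [k ^+ 2], that is of
    [2 q x x y y + 4 q x y x y]. *)
Lemma polarization (q : V -> V -> V -> V -> R) x y : D x -> D y ->
  (forall k a a' b c d, q (k *: a + a') b c d = k * q a b c d + q a' b c d) ->
  (forall a b c d, D a -> D b -> D c -> D d -> q a b c d = q b a c d) ->
  (forall a b c d, D a -> D b -> D c -> D d -> q a b c d = q c d a b) ->
  (forall a, D a -> q a a a a = 0) ->
  q x x y y + 2 * q x y x y = 0.
Proof.
move=> Dx Dy q1 q12 q13 q0.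
have q2 k a a' b c d : D a -> D a' -> D b -> D c -> D d ->
    q b (k *: a + a') c d = k * q b a c d + q b a' c d.
  by move=> *; rewrite q12 // ?q1 1?q12 // ?(q12 a') //; exact: DD.
have q3 k a a' b c d : D a -> D a' -> D b -> D c -> D d ->
    q b c (k *: a + a') d = k * q b c a d + q b c a' d.
  by move=> *; rewrite q13 // ?q1 1?q13 // ?(q13 a') //; exact: DD.
have q4 k a a' b c d : D a -> D a' -> D b -> D c -> D d ->
    q b c d (k *: a + a') = k * q b c d a + q b c d a'.
  by move=> *; rewrite q13 // ?q2 // 1?q13 // ?(q13 d a') //; exact: DD.
have q34 a b c d : D a -> D b -> D c -> D d -> q a b c d = q a b d c.
  by move=> *; rewrite q13 // q12 // q13.
have E k : q (k *: x + y) (k *: x + y) (k *: x + y) (k *: x + y) =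
    k ^+ 4 * q x x x x + 4 * k ^+ 3 * q x x x y
    + k ^+ 2 * (2 * q x x y y + 4 * q x y x y) + 4 * k * q x y y y + q y y y y.
  have Dk := DD k Dx Dy.
  rewrite q1 !q2 // !q3 // !q4 //.
  rewrite (q12 y x) // (q12 y x) // (q12 y x) // (q12 y x) //.
  rewrite ?(q34 x y y x) // ?(q34 x x y x) // ?(q34 y y y x) //.
  rewrite ?(q13 y y x x) // ?(q13 x y x x) // ?(q13 y y x y) //.
  by ring.
have := E 1; have := E (-1); rewrite !q0 //; try exact: DD.
lra.
Qed.

(** A Kaehler-like curvature tensor on [D] with vanishing holomorphic sectional
    curvature is zero: polarize [q a b c d := S a (J b) c (J d)], then eliminate
    with the Bianchi identity. *)
Lemma kaehler_zero (S : V -> V -> V -> V -> R) x y w : D x -> D y -> D w ->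
  (forall k a a' b c d, S (k *: a + a') b c d = k * S a b c d + S a' b c d) ->
  (forall a b c d, S a b c d = - S b a c d) ->
  (forall a b c d, S a b c d = S c d a b) ->
  (forall a b c d, S a b c d + S b c a d + S c a b d = 0) ->
  (forall a b c d, D a -> D b -> D c -> D d -> S a b (J c) (J d) = S a b c d) ->
  (forall a, D a -> S a (J a) (J a) a = 0) ->
  S x y x w = 0.
Proof.
move=> Dx Dy Dw S1 S12 S13 SB SJ S0.
have S34 a b c d : S a b c d = - S a b d c by rewrite S13 S12 S13.
have SN a b c d : S (- a) b c d = - S a b c d.
  rewrite -[- a]addr0 -scaleN1r S1 -[X in _ + X](_ : 0 = _) ?addr0 ?mulN1r //.
  by have := S1 1 0 0 b c d; rewrite scaler0 addr0; lra.
have SJ' a b c d : D a -> D b -> D c -> D d -> S (J a) (J b) c d = S a b c d.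
  by move=> *; rewrite S13 SJ // S13.
have JS a b c d : D a -> D b -> D c -> D d -> S (J a) b c d = - S a (J b) c d.
  move=> Da Db Dc Dd; rewrite -(SJ' (J a) b) //; last exact: DJ.
  by rewrite JJ // SN.
(* Bianchi on [a], [J a], [b] against [J b] turns [q a a b b] into [S a (J b) a (J b) + S a b a b];
   with the polarized identity this makes the factor 3. *)
have main a b : D a -> D b -> 3 * S a (J b) a (J b) + S a b a b = 0.
  move=> Da Db; have DJa := DJ Da; have DJb := DJ Db.
  pose q a b c d := S a (J b) c (J d).
  have : q a a b b + 2 * q a b a b = 0.
    apply: polarization => //; rewrite /q.
    - move=> k c c' e f g; exact: S1.
    - by move=> c e f g Dc De Df Dg; rewrite S12 JS ?opprK //; exact: DJ.
    - by move=> c e f g *; exact: S13.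
    - by move=> c Dc; rewrite S34 S0 // oppr0.
  have := SB a (J a) b (J b); rewrite /q.
  rewrite (JS a b a) //.
  have -> : S b a (J a) (J b) = - S a b a b by rewrite SJ // S12.
  lra.
(* [main] for [b] and for [J b] is a linear system with matrix (3 1; 1 3) in the two unknowns. *)
have zero a b : D a -> D b -> S a b a b = 0.
  move=> Da Db; have := main a b Da Db; have := main a (J b) Da (DJ Db).
  have -> : S a (J (J b)) a (J (J b)) = S a b a b.
    by rewrite JJ // S12 SN opprK S34 S13 SN opprK S34 S13 S34 S12 !opprK.
  lra.
(* Polarizing [S x y x y = 0] in [y] gives [S x y x w + S x w x y = 0], and the two terms agree by
   pair symmetry. *)
have Dyw : D (y + w) by rewrite -[y]scale1r; exact: DD.
have := zero x _ Dx Dyw.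
have S2 a b b' c d : S a (b + b') c d = S a b c d + S a b' c d.
  by rewrite S12 -[b]scale1r S1 mul1r scale1r opprD -S12 -S12.
have S4' a b b' c d : S c d a (b + b') = S c d a b + S c d a b'.
  by rewrite S13 S2 S13 [X in _ + X]S13.
rewrite S2 !S4' !zero // (S13 x w x y); lra.
Qed.

End KaehlerAlgebra.

(** * Contact metric structure at a point *)

Section ContactAlgebra.
Context {R : realType} {m : nat}.
Variables (G phi : 'M[R]_m) (xi : 'rV[R]_m) (eta : 'cV[R]_m).
Hypotheses (Gp : posdef G) (phi2 : phi *m phi = - 1%:M + eta *m xi)
  (etaxi : pairing eta xi = 1)
  (mphi : forall v w, ip G (v *m phi) (w *m phi) = ip G v w - pairing eta v * pairing eta w).
Implicit Types v w : 'rV[R]_m.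

Lemma phi_phi v : v *m phi *m phi = - v + pairing eta v *: xi.
Proof.
rewrite -mulmxA phi2 mulmxDr mulmxN mulmx1 mulmxA; congr (_ + _).
by rewrite [v *m eta]mx11_scalar mul_scalar_mx.
Qed.

Lemma xi_neq0 : xi != 0.
Proof.
apply/eqP => xi0; move: etaxi; rewrite xi0 /pairing mul0mx mxE => /eqP.
by rewrite eq_sym oner_eq0.
Qed.

(** As [eta xi = 1], phi^2 kills [xi]. Then phi^2 at [phi xi] gives [phi xi = a xi] with
    [a = eta (phi xi)], so that [a^2 xi = phi^2 xi = 0] and [a = 0]. *)
Lemma xi_phi : xi *m phi = 0.
Proof.
have e0 : xi *m phi *m phi = 0 by rewrite phi_phi etaxi scale1r addNr.
have := phi_phi (xi *m phi); rewrite e0 mul0mx => /eqP; rewrite eq_sym addrC subr_eq0 => /eqP E.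
have E2 : pairing eta (xi *m phi) ^+ 2 *: xi = 0.
  by rewrite expr2 -scalerA E scalemxAl E e0.
have : pairing eta (xi *m phi) ^+ 2 == 0.
  by move/eqP: E2; rewrite scaler_eq0 (negbTE xi_neq0) orbF.
by rewrite sqrf_eq0 => /eqP a0; rewrite -E a0 scale0r.
Qed.

(** Compare the two ways of computing phi^3: they differ by the [xi] term. *)
Lemma eta_phi v : pairing eta (v *m phi) = 0.
Proof.
have := phi_phi (v *m phi).
rewrite (phi_phi v) mulmxDl mulNmx -scalemxAl xi_phi scaler0 => /addrI/eqP.
by rewrite eq_sym scaler_eq0 (negbTE xi_neq0) orbF => /eqP.
Qed.

Lemma ip_xi v : ip G v xi = pairing eta v.
Proof.
have := mphi v xi; rewrite xi_phi ip0r etaxi mulr1 => /eqP.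
by rewrite eq_sym subr_eq0 => /eqP.
Qed.

Lemma phi_skew v w : ip G (v *m phi) w = - ip G v (w *m phi).
Proof.
have := mphi v (w *m phi).
rewrite phi_phi eta_phi mulr0 subr0 ipDr ipNr ipZr ip_xi eta_phi mulr0 addr0 => <-.
by rewrite opprK.
Qed.

Lemma ip_phi_self v : ip G v (v *m phi) = 0.
Proof. by have := phi_skew v v; rewrite (ip_sym _ _ Gp.1); lra. Qed.

End ContactAlgebra.

(** * Horizontal curvature of a Sasakian space form at a point *)

Section SpaceForm.
Context {R : realType} {m : nat}.
Variables (G phi : 'M[R]_m) (xi : 'rV[R]_m) (eta : 'cV[R]_m).
Hypotheses (Gp : posdef G) (phi2 : phi *m phi = - 1%:M + eta *m xi)
  (etaxi : pairing eta xi = 1)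
  (mphi : forall v w, ip G (v *m phi) (w *m phi) = ip G v w - pairing eta v * pairing eta w).
Variables (Rm : 'rV[R]_m -> 'rV[R]_m -> 'rV[R]_m -> 'rV[R]_m) (c : R).
Hypotheses (R1 : forall k a a' b z, Rm (k *: a + a') b z = k *: Rm a b z + Rm a' b z)
  (R12 : forall a b z, Rm a b z = - Rm b a z)
  (RB : forall a b z, Rm a b z + Rm b z a + Rm z a b = 0)
  (R34 : forall a b z w, ip G (Rm a b z) w = - ip G (Rm a b w) z)
  (Rphi : forall a b z, Rm a b (z *m phi) = Rm a b z *m phi - ip G b z *: (a *m phi)
     + ip G a z *: (b *m phi) + ip G z (a *m phi) *: b - ip G z (b *m phi) *: a)
  (Rc : forall a, ip G a a = 1 -> ip G a xi = 0 ->
     ip G (Rm a (a *m phi) (a *m phi)) a = c).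
Implicit Types a b z w x y : 'rV[R]_m.

Let s v w : ip G v w = ip G w v. Proof. exact/ip_sym/Gp.1. Qed.
Let sk := phi_skew phi2 etaxi mphi.
Let horiz v := pairing eta v = 0.

(** The curvature tensor of the space form on horizontal vectors. *)
Definition sasaki_form a b z w : R :=
  (c + 3) / 4 * (ip G b z * ip G a w - ip G a z * ip G b w)
  + (c - 1) / 4 * (ip G z (b *m phi) * ip G (a *m phi) w
      - ip G z (a *m phi) * ip G (b *m phi) w + 2 * ip G a (b *m phi) * ip G (z *m phi) w).

(** Classical combination of the four cyclic Bianchi identities on [a], [b], [z], [w] with the two
    antisymmetries. *)
Lemma curvature_pair_sym a b z w : ip G (Rm a b z) w = ip G (Rm z w a) b.
Proof.
have B x y t u : ip G (Rm x y t) u + ip G (Rm y t x) u + ip G (Rm t x y) u = 0.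
  by rewrite -!ipDl RB ip0l.
have A x y t u : ip G (Rm x y t) u = - ip G (Rm y x t) u by rewrite R12 ipNl.
have := B a b z w; rewrite (A z a b w).
have := B b z w a; rewrite (R34 b z w a) (R34 z w b a) (A w b z a) (R34 b w z a).
have := B z w a b; rewrite (A w a z b) (R34 a w z b) (R34 a z w b).
have := B w a b z; rewrite (A w a b z) (R34 a b w z).
lra.
Qed.

Lemma sasaki_form_lin k a a' b z w :
  sasaki_form (k *: a + a') b z w = k * sasaki_form a b z w + sasaki_form a' b z w.
Proof.
by rewrite /sasaki_form !mulmxDl -!scalemxAl !(ipDr, ipZr, ipDl, ipZl); ring.
Qed.

Let o v w : ip G v (w *m phi) = - ip G w (v *m phi).
Proof. by rewrite -sk s. Qed.

Lemma sasaki_form_antisym a b z w : sasaki_form a b z w = - sasaki_form b a z w.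
Proof. by rewrite /sasaki_form (o b a); ring. Qed.

Lemma sasaki_form_pair a b z w : sasaki_form a b z w = sasaki_form z w a b.
Proof.
by rewrite /sasaki_form !sk (s w a) (s z b) (s z a) (s w b) (o a z) (o w b); ring.
Qed.

Lemma sasaki_form_bianchi a b z w :
  sasaki_form a b z w + sasaki_form b z a w + sasaki_form z a b w = 0.
Proof.
by rewrite /sasaki_form !sk (s b a) (s z a) (s b z) (o z b) (o b a) (o z a); ring.
Qed.

(** Curvature minus model. Both fail to commute with phi by the same terms, so the difference is
    Kaehler-like on horizontal vectors. *)
Let HS a b z w := ip G (Rm a b z) w - sasaki_form a b z w.

(** The two blocks of [sasaki_form] have opposite commutators with phi, and their coefficients
    differ by [(c + 3) / 4 - (c - 1) / 4 = 1]: this is the coefficient of the correction terms in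
    [Rphi]. Replacing [w] by [phi w] turns the lemma into invariance under phi. *)
Let phi_skew_S a b z w : horiz z -> horiz w ->
  HS a b (z *m phi) w + HS a b z (w *m phi) = 0.
Proof.
move=> hz hw; rewrite /HS Rphi !(ipDl, ipNl, ipZl) /sasaki_form.
rewrite (mphi z b) (mphi z a) (mphi a w) (mphi b w) (mphi z w) (phi_phi phi2 z).
rewrite hz hw scale0r addr0 ipNl !sk (s z a) (s z b) (o b z) (o a z).
by field.
Qed.

Lemma curvature_horizontal x y w : horiz x -> horiz y -> horiz w ->
  ip G (Rm x y x) w = sasaki_form x y x w.
Proof.
move=> hx hy hw; apply/eqP; rewrite -subr_eq0 -/(HS x y x w); apply/eqP.
have hD k a b : horiz a -> horiz b -> horiz (k *: a + b).
  by rewrite /horiz /pairing mulmxDl -scalemxAl !mxE => -> ->; rewrite mulr0 addr0.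
have hJ a : horiz a -> horiz (a *m phi).
  by move=> _; exact: (eta_phi phi2 etaxi).
have JJ a : horiz a -> a *m phi *m phi = - a.
  by move=> ha; rewrite (phi_phi phi2) ha scale0r addr0.
apply: (@kaehler_zero R _ horiz (fun v => v *m phi) hD hJ JJ HS) => //.
- by move=> k a a' b z t; rewrite /HS R1 sasaki_form_lin ipDl ipZl; ring.
- by move=> a b z t; rewrite /HS R12 sasaki_form_antisym ipNl opprB opprK addrC.
- by move=> a b z t; rewrite /HS curvature_pair_sym sasaki_form_pair.
- move=> a b z t; rewrite /HS; have := sasaki_form_bianchi a b z t.
  have : ip G (Rm a b z) t + ip G (Rm b z a) t + ip G (Rm z a b) t = 0.
    by rewrite -!ipDl RB ip0l.
  lra.
- move=> a b z t ha hb hz ht.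
  have := phi_skew_S a b hz (hJ _ ht).
  rewrite (phi_phi phi2) ht scale0r addr0.
  have -> : HS a b z (- t) = - HS a b z t.
    rewrite /HS /sasaki_form !ipNr; ring.
  lra.
move=> a ha; rewrite /HS.
have [->|a0] := eqVneq a 0.
  by rewrite /sasaki_form !mul0mx !(ip0l, ip0r); ring.
pose n := ip G a a; have n0 : 0 < n by exact: Gp.2.
(* [Rc] speaks of unit vectors only. Rescaling [a] by [r] multiplies the curvature term by [r^4], so
   its value at [a] is [n^2 c]; the model gives [((c + 3) + 3 (c - 1)) / 4 * n^2], which is the
   same. *)
pose r := (Num.sqrt n)^-1; have rr : r * r * n = 1.
  by rewrite /r -invfM -expr2 sqr_sqrtr ?ltW// mulVf// gt_eqF.
have r0 : r != 0.
  by apply/eqP => r0; move: rr; rewrite r0 !mul0r => /eqP; rewrite eq_sym oner_eq0.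
have H1 : ip G (r *: a) (r *: a) = 1 by rewrite ipZl ipZr mulrA.
have H2 : ip G (r *: a) xi = 0.
  by rewrite ipZl (ip_xi phi2 etaxi mphi) ha mulr0.
have := Rc H1 H2; rewrite -scalemxAl.
have R1Z k x' y' z' : Rm (k *: x') y' z' = k *: Rm x' y' z'.
  have := R1 k x' 0 y' z'; have := R1 1 0 0 y' z'.
  rewrite scaler0 !addr0 scale1r => /eqP; rewrite -subr_eq0 opprD addrA subrr sub0r oppr_eq0.
  by move=> /eqP ->; rewrite addr0.
have RmZ (p q t u : 'rV[R]_m) : ip G (Rm (r *: p) (r *: q) (r *: t)) (r *: u) =
    (r * r) * (r * r) * ip G (Rm p q t) u.
  rewrite ipZr R1Z ipZl R12 R1Z ipNl ipZl (R34 q p) ipZr (R34 q p u) (R12 q p) ipNl.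
  by ring.
rewrite RmZ => E.
have aJ : ip G a (a *m phi) = 0 by exact: (ip_phi_self Gp phi2 etaxi mphi).
rewrite /sasaki_form (JJ a ha) (mphi a a) ha !(ipNl, ipNr) (s (a *m phi) a) aJ -/n.
move: E; move: (ip G (Rm _ _ _) _) => X E.
have -> : X = n * n * c.
  by rewrite -E -[LHS]mul1r -[X in X * _](mulr1 1) -{1 2}rr; ring.
by field.
Qed.

(** Polarization in the first and third arguments, the form in which a trace with a symmetric matrix
    uses it. *)
Lemma curvature_horizontal_polar x x' y w : horiz x -> horiz x' -> horiz y -> horiz w ->
  ip G (Rm x y x') w + ip G (Rm x' y x) w =
  sasaki_form x y x' w + sasaki_form x' y x w.
Proof.
move=> hx hx' hy hw.
have RD b z : Rm (x + x') b z = Rm x b z + Rm x' b z.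
  by have := R1 1 x x' b z; rewrite !scale1r.
have SD b z t : sasaki_form (x + x') b z t = sasaki_form x b z t + sasaki_form x' b z t.
  by have := sasaki_form_lin 1 x x' b z t; rewrite scale1r mul1r.
have hxx : horiz (x + x') by rewrite /horiz /pairing mulmxDl mxE -!/(pairing _ _) hx hx' addr0.
have R3 b t : ip G (Rm b y (x + x')) t = ip G (Rm b y x) t + ip G (Rm b y x') t.
  by rewrite !(curvature_pair_sym b y) RD ipDl.
have S3 b t : sasaki_form b y (x + x') t = sasaki_form b y x t + sasaki_form b y x' t.
  by rewrite !(sasaki_form_pair b y) SD.
have := curvature_horizontal hxx hy hw.
have := curvature_horizontal hx hy hw.
have := curvature_horizontal hx' hy hw.
rewrite RD ipDl !R3 SD !S3; lra.
Qed.

End SpaceForm.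

(** * Curvature identities from the Sasakian condition *)

Section SasakianCurvature.
Context {R : realType} {m : nat}.
Variables (U' : set 'rV[R]_m) (h phi : 'rV[R]_m -> 'M[R]_m)
  (xi : 'rV[R]_m -> 'rV[R]_m) (eta : 'rV[R]_m -> 'cV[R]_m).
Hypotheses (oU' : open U') (sh : smooth_on U' h) (hp : forall y, U' y -> posdef (h y))
  (sphi : smooth_on U' phi) (sxi : smooth_on U' xi)
  (phi2 : forall y, U' y -> phi y *m phi y = - 1%:M + eta y *m xi y)
  (etaxi : forall y, U' y -> pairing (eta y) (xi y) = 1)
  (mphi : forall y v w, U' y -> ip (h y) (v *m phi y) (w *m phi y) =
     ip (h y) v w - pairing (eta y) v * pairing (eta y) w).
Local Notation D := (conn h id).
Hypothesis sas : forall y v (V : 'rV[R]_m -> 'rV[R]_m), U' y -> smooth_on U' V ->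
  D v (fun x => V x *m phi x) y - D v V y *m phi y =
  ip (h y) v (V y) *: xi y - pairing (eta y) (V y) *: v.
Implicit Types (a b z v y : 'rV[R]_m).

Let sc (a : 'rV[R]_m) : smooth_on U' (fun=> a). Proof. exact: smooth_on_cst. Qed.
Let idU (y : 'rV[R]_m) : U' y -> U' (id y). Proof. by []. Qed.
Let sid : smooth_on U' (id : 'rV[R]_m -> 'rV[R]_m) := @smooth_on_id R _ U'.
Let sD a V : smooth_on U' V -> smooth_on U' (D a V).
Proof. exact: (smooth_conn oU' sh hp oU' sid idU). Qed.
Let cip v V W y (Uy : U' y) := conn_ip oU' sh hp sid idU v Uy (V := V) (W := W).
Let ipxi y v (Uy : U' y) := ip_xi (phi2 Uy) (etaxi Uy) (fun v w => mphi v w Uy) v.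
Let xiphi y (Uy : U' y) := xi_phi (phi2 Uy) (etaxi Uy).
Let skew y (Uy : U' y) := phi_skew (phi2 Uy) (etaxi Uy) (fun v w => mphi v w Uy).

(** The Sasakian condition on the field [xi], where [phi xi = 0], determines [phi (D_v xi)].
    Applying phi again recovers [D_v xi] up to its [xi] component, which vanishes because [xi] has
    constant length. *)
Lemma conn_xi v y : U' y -> D v xi y = - (v *m phi y).
Proof.
move=> Uy; have := sas v Uy sxi.
have -> : D v (fun x => xi x *m phi x) y = 0.
  transitivity (D v (fun=> 0) y); last exact: conn0.
  by apply: (conn_ext h id oU' v Uy) => x Ux; exact: xiphi.
rewrite sub0r ipxi // etaxi // scale1r => /(congr1 (mulmx^~ (phi y))) /=.
rewrite mulNmx (phi_phi (phi2 Uy)) mulmxBl -scalemxAl xiphi // scaler0 sub0r.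
have -> : pairing (eta y) (D v xi y) = 0.
  rewrite -ipxi //.
  have := cip v Uy sxi sxi.
  have -> : 'D_v (fun x => ip (h x) (xi x) (xi x)) y = 0.
    transitivity ('D_v (fun=> 1 : R) y); last exact: derive_cst.
    by apply: (derive_ext _ oU' Uy) => x Ux; rewrite ipxi // etaxi.
  by rewrite /= (ip_sym (xi y) _ (hp Uy).1); lra.
by rewrite scale0r addr0 opprK.
Qed.

Lemma curvature_xi a b y : U' y ->
  curvature_at h y a b (xi y) =
  pairing (eta y) b *: a - pairing (eta y) a *: b.
Proof.
move=> Uy; rewrite (curvature_field oU' sh hp a b Uy sxi).
have E a' b' : D a' (D b' xi) y = - (D a' (fun=> b') y *m phi y
    + ip (h y) a' b' *: xi y - pairing (eta y) b' *: a').
  transitivity (D a' (fun x => - (b' *m phi x)) y).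
    by apply: (conn_ext h id oU' a' Uy) => x Ux; exact: conn_xi.
  have sb : smooth_on U' (fun x => b' *m phi x) by apply: smooth_on_mulmx.
  rewrite (connN h id oU' a' Uy sb); congr (- _).
  by rewrite -addrA -(sas a' Uy (sc b')) addrC subrK.
rewrite (E a b) (E b a) (conn_cst_sym oU' sh hp a b Uy) (ip_sym a b (hp Uy).1).
move: (_ *m phi y) => A.
by apply/rowP => i; rewrite !mxE; ring.
Qed.

(** Differentiate the Sasakian condition once more and antisymmetrize in [a], [b]. All terms along
    [xi] and all those with [eta] are symmetric, so only products of the metric with phi survive. *)
Lemma curvature_phi a b z y : U' y ->
  curvature_at h y a b (z *m phi y) = curvature_at h y a b z *m phi y
  - ip (h y) b z *: (a *m phi y) + ip (h y) a z *: (b *m phi y)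
  + ip (h y) z (a *m phi y) *: b - ip (h y) z (b *m phi y) *: a.
Proof.
move=> Uy.
have sz : smooth_on U' (fun x => z *m phi x) by apply: smooth_on_mulmx.
rewrite (curvature_field oU' sh hp a b Uy sz) (curvature_cst oU' sh hp a b z Uy).
pose Z b := D b (fun=> z).
have sZ b' : smooth_on U' (Z b') by exact: sD.
have E a' b' : D a' (D b' (fun x => z *m phi x)) y =
    D a' (Z b') y *m phi y + ip (h y) a' (Z b' y) *: xi y
    - pairing (eta y) (Z b' y) *: a'
    + ((ip (h y) (D a' (fun=> b') y) z + ip (h y) b' (Z a' y)) *: xi y
      - ip (h y) b' z *: (a' *m phi y))
    - ((pairing (eta y) (Z a' y) - ip (h y) z (a' *m phi y)) *: b'
      + pairing (eta y) z *: D a' (fun=> b') y).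
  have s1 : smooth_on U' (fun x => Z b' x *m phi x) by apply: smooth_on_mulmx.
  have i1 : smooth_on U' (fun x => ip (h x) b' z) by exact: smooth_on_ip.
  (* The function [eta z] is differentiated in the form [ip z xi], through metric compatibility and
     [conn_xi]. *)
  have i2 : smooth_on U' (fun x => ip (h x) z (xi x)) by exact: smooth_on_ip.
  have s2 : smooth_on U' (fun x => ip (h x) b' z *: xi x) by exact: smooth_on_scale.
  have s3 : smooth_on U' (fun x => ip (h x) z (xi x) *: b') by exact: smooth_on_scale.
  transitivity (D a' (fun x => Z b' x *m phi x + ip (h x) b' z *: xi x
                               - ip (h x) z (xi x) *: b') y).
    apply: (conn_ext h id oU' a' Uy) => x Ux.
    by rewrite ipxi // -addrA -(sas b' Ux (sc z)) addrC subrK.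
  rewrite (connB h id oU' a' Uy (smooth_onD oU' s1 s2) s3) (connD h id a' Uy s1 s2).
  rewrite (connM h id oU' a' Uy i1 sxi) (connM h id oU' a' Uy i2 (sc b')).
  rewrite conn_xi // ipxi //.
  rewrite (cip a' Uy (sc b') (sc z)) (cip a' Uy (sc z) sxi) /= conn_xi // ipNr ipxi //.
  rewrite scalerN; congr (_ + _ - _).
  by rewrite -addrA -(sas a' Uy (sZ b')) addrC subrK.
rewrite (E a b) (E b a) (conn_cst_sym oU' sh hp a b Uy) mulmxBl.
move: (D a (Z b) y *m _) (D b (Z a) y *m _) => A B.
by apply/rowP => i; rewrite !mxE; ring.
Qed.

End SasakianCurvature.

(** * Bitension of an isometric immersion *)

Section Submanifold.
Context {R : realType} {n m : nat}.
Variables (U' : set 'rV[R]_m) (h : 'rV[R]_m -> 'M[R]_m).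
Hypotheses (oU' : open U') (sh : smooth_on U' h) (hp : forall y, U' y -> posdef (h y)).
Variables (U : set 'rV[R]_n) (F : 'rV[R]_n -> 'rV[R]_m) (k : 'rV[R]_n -> 'M[R]_n).
Hypotheses (oU : open U) (sF : smooth_on U F) (FU : forall u, U u -> U' (F u)).
Hypotheses (sk : smooth_on U k) (kp : forall u, U u -> posdef (k u)).
Hypothesis kF : forall u v w, U u ->
  ip (k u) v w = ip (h (F u)) (push F v u) (push F w u).
Implicit Types (u v w : 'rV[R]_n) (x y : 'rV[R]_m) (V W : 'rV[R]_n -> 'rV[R]_m).

Local Notation pushforward := Defs.pushforward.
Local Notation D := (conn h F).
Local Notation e := (delta_mx 0).
Local Notation K u := (invmx (k u)).
Local Notation E i := (push F (e i)).

Let sE v : smooth_on U (push F v). Proof. exact: smooth_push. Qed.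
Let sD v V : smooth_on U V -> smooth_on U (D v V).
Proof. exact: (smooth_conn oU' sh hp oU sF FU). Qed.
Let cip v V W u (Uu : U u) := conn_ip oU' sh hp sF FU v Uu (V := V) (W := W).
Let shF : smooth_on U (fun u => h (F u)).
Proof. exact: (smooth_on_comp oU oU' FU sF sh). Qed.
Let ips u (Uu : U u) x y : ip (h (F u)) x y = ip (h (F u)) y x.
Proof. exact/ip_sym/(hp (FU Uu)).1. Qed.
Let smip V W : smooth_on U V -> smooth_on U W ->
  smooth_on U (fun u => ip (h (F u)) (V u) (W u)).
Proof. exact: smooth_on_ip. Qed.
Let sK i j : smooth_on U (fun u => K u i j).
Proof.
by apply: (smooth_on_mx oU _).1; apply: smooth_on_invmx => // u /kp/posdef_unit.
Qed.
Let psym v w u (Uu : U u) := conn_push_sym oU' sh hp oU sF FU v w Uu.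

Lemma pullback_connectionE X V u : pullback_connection h F X V u = D (X u) V u.
Proof. by rewrite conn.unlock. Qed.

Lemma pushforwardE X u : pushforward F X u = push F (X u) u.
Proof. by rewrite push.unlock. Qed.

Lemma pushforward_cst v : pushforward F (cst v) = push F v.
Proof. by apply/funext => u; rewrite pushforwardE. Qed.

Lemma pullback_connection_cst v V : pullback_connection h F (cst v) V = D v V.
Proof. by apply/funext => u; rewrite pullback_connectionE. Qed.

Lemma traceE l (T : _ -> _ -> _ -> 'rV[R]_l) u :
  trace k T u = \sum_i \sum_j K u i j *: T (cst (e i)) (cst (e j)) u.
Proof. by []. Qed.

Lemma invmx_sym u i j : U u -> K u i j = K u j i.
Proof. by move=> Uu; rewrite -[in RHS](kp Uu).1 -trmx_inv mxE. Qed.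

(** Index raising: the vector whose [k]-products with the coordinate frame are the [a i]. The double
    sum has the shape of [trace]. *)
Definition raise u (a : 'I_n -> R) : 'rV[R]_n := \sum_i \sum_j K u i j *: (a i *: e j).

Lemma raiseE u a j : raise u a 0 j = \sum_i a i * K u i j.
Proof.
rewrite /raise summxE; apply: eq_bigr => i _; rewrite summxE (bigD1 j) //= !mxE !eqxx mulr1.
rewrite big1 ?addr0 1?mulrC // => l lj.
by rewrite !mxE eqxx /= eq_sym (negbTE lj) !mulr0.
Qed.

Lemma raise_ip u a l : U u -> ip (k u) (raise u a) (e l) = a l.
Proof.
move=> Uu; have -> : raise u a = (\row_i a i) *m K u.
  by apply/rowP => j; rewrite raiseE !mxE; apply: eq_bigr => i _; rewrite mxE.
rewrite /ip mulmxKV; last exact: (posdef_unit (kp Uu)).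
by rewrite trmx_delta -colE !mxE.
Qed.

Lemma ip_k_inj u v w : U u -> (forall l, ip (k u) v (e l) = ip (k u) w (e l)) -> v = w.
Proof.
move=> Uu vw; apply/eqP; rewrite -subr_eq0; apply/eqP.
by apply: (ip_nondeg (posdef_unit (kp Uu))) => l; rewrite ipBl vw subrr.
Qed.

(** Acts on single vectors, whereas [tangent_part] acts on sections; linearity can thus be used at
    one point. *)
Definition tangent_comp u x : 'rV[R]_n := raise u (fun i => ip (h (F u)) x (E i u)).
Definition normal_comp u x : 'rV[R]_m := x - push F (tangent_comp u x) u.

Lemma tangent_partE V u : tangent_part k h F V u = tangent_comp u (V u).
Proof.
rewrite /tangent_part traceE /tangent_comp /raise.
by do 2!(apply: eq_bigr => ? _); rewrite pushforward_cst.
Qed.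

Lemma normal_partE V u : normal_part k h F V u = normal_comp u (V u).
Proof. by rewrite /normal_part pushforwardE tangent_partE. Qed.

Lemma pushD u v w : U u -> push F (v + w) u = push F v u + push F w u.
Proof. by move=> Uu; rewrite -[v]scale1r (push_lin sF) // !scale1r. Qed.
Lemma push0 u : U u -> push F 0 u = 0.
Proof. by move=> Uu; apply: (@addrI _ (push F 0 u)); rewrite -pushD // !addr0. Qed.
Lemma pushZ u (a : R) v : U u -> push F (a *: v) u = a *: push F v u.
Proof. by move=> Uu; rewrite -[a *: v]addr0 (push_lin sF) // push0 // addr0. Qed.
Lemma pushN u v : U u -> push F (- v) u = - push F v u.
Proof. by move=> Uu; rewrite -scaleN1r pushZ // scaleN1r. Qed.
Lemma push_row u v : U u -> push F v u = \sum_i v 0 i *: E i u.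
Proof.
move=> Uu; rewrite {1}(row_sum_delta v); elim/big_rec2: _ => [|i a b _ <-].
  exact: push0.
by rewrite pushD // pushZ.
Qed.

Lemma ip_push_row u x v : U u ->
  ip (h (F u)) x (push F v u) = \sum_l v 0 l * ip (h (F u)) x (E l u).
Proof. by move=> Uu; rewrite push_row // ip_sumr; apply: eq_bigr => l _; rewrite ipZr. Qed.

Lemma tangent_comp_ip u x v : U u ->
  ip (k u) (tangent_comp u x) v = ip (h (F u)) x (push F v u).
Proof.
move=> Uu; rewrite ip_row ip_push_row //; apply: eq_bigr => l _.
by rewrite raise_ip.
Qed.

Lemma tangent_comp_lin u (a : R) x y : U u ->
  tangent_comp u (a *: x + y) = a *: tangent_comp u x + tangent_comp u y.
Proof.
by move=> Uu; apply: (ip_k_inj Uu) => l; rewrite ipDl ipZl !tangent_comp_ip // ipDl ipZl.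
Qed.

Lemma normal_comp_ip u x v : U u -> ip (h (F u)) (normal_comp u x) (push F v u) = 0.
Proof. by move=> Uu; rewrite /normal_comp ipBl -kF // tangent_comp_ip // subrr. Qed.

Lemma normal_comp_lin u (a : R) x y : U u ->
  normal_comp u (a *: x + y) = a *: normal_comp u x + normal_comp u y.
Proof.
move=> Uu; rewrite /normal_comp tangent_comp_lin // (push_lin sF) // scalerBr.
by rewrite opprD addrACA.
Qed.
Lemma normal_compD u x y : U u -> normal_comp u (x + y) = normal_comp u x + normal_comp u y.
Proof. by move=> Uu; rewrite -[x]scale1r normal_comp_lin // !scale1r. Qed.
Lemma normal_comp0 u : U u -> normal_comp u 0 = 0.
Proof. by move=> Uu; apply: (@addrI _ (normal_comp u 0)); rewrite -normal_compD // !addr0. Qed.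
Lemma normal_compZ u (a : R) x : U u -> normal_comp u (a *: x) = a *: normal_comp u x.
Proof. by move=> Uu; rewrite -[a *: x]addr0 normal_comp_lin // normal_comp0 // addr0. Qed.
Lemma normal_compN u x : U u -> normal_comp u (- x) = - normal_comp u x.
Proof. by move=> Uu; rewrite -scaleN1r normal_compZ // scaleN1r. Qed.
Lemma normal_compB u x y : U u -> normal_comp u (x - y) = normal_comp u x - normal_comp u y.
Proof. by move=> Uu; rewrite normal_compD // normal_compN. Qed.
Lemma normal_comp_sum u I (r : seq I) (f : I -> 'rV[R]_m) : U u ->
  normal_comp u (\sum_(i <- r) f i) = \sum_(i <- r) normal_comp u (f i).
Proof.
by move=> Uu; elim/big_rec2: _ => [|i a b _ <-]; [exact: normal_comp0|exact: normal_compD].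
Qed.

Lemma normal_comp_id u x : U u -> (forall l, ip (h (F u)) x (E l u) = 0) ->
  normal_comp u x = x.
Proof.
move=> Uu x0; have -> : normal_comp u x = x - push F 0 u; last by rewrite push0 // subr0.
congr (_ - push F _ u); apply: (ip_k_inj Uu) => l.
by rewrite tangent_comp_ip // x0 ip0l.
Qed.

Lemma ip_normal u x v : U u -> (forall l, ip (h (F u)) x (E l u) = 0) ->
  ip (h (F u)) x (push F v u) = 0.
Proof. by move=> Uu x0; rewrite ip_push_row // big1 // => l _; rewrite x0 mulr0. Qed.

Lemma ip_normal_comp u x y : U u -> (forall l, ip (h (F u)) x (E l u) = 0) ->
  ip (h (F u)) x (normal_comp u y) = ip (h (F u)) x y.
Proof. by move=> Uu x0; rewrite /normal_comp ipBr ip_normal // subr0. Qed.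

Lemma smooth_push_field (v : 'rV[R]_n -> 'rV[R]_n) : smooth_on U v ->
  smooth_on U (fun u => push F (v u) u).
Proof.
move=> sv; apply: (@smooth_on_ext _ _ _ _ oU (fun u => \sum_i v u 0 i *: E i u)).
  by move=> u Uu; rewrite push_row.
apply: smooth_on_sum => // i; apply: smooth_on_scale => //.
exact: (smooth_on_mx oU _).1.
Qed.

Lemma smooth_tangent_comp V : smooth_on U V -> smooth_on U (fun u => tangent_comp u (V u)).
Proof.
move=> sV; rewrite /tangent_comp /raise.
do 2!(apply: smooth_on_sum => // ?); apply: smooth_on_scale => //.
apply: smooth_on_scale => //; last exact: smooth_on_cst.
exact: smip.
Qed.

Lemma smooth_normal_comp V : smooth_on U V -> smooth_on U (fun u => normal_comp u (V u)).
Proof.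
by move=> sV; apply: smooth_onB => //; apply: smooth_push_field; exact: smooth_tangent_comp.
Qed.

(** Gauss formula. Both sides are compared by their products with the frame: the Koszul formula for
    [k], whose derivatives are expanded by metric compatibility along [F] and collapse by absence of
    torsion. *)
Lemma christoffel_tangent v w u : U u ->
  christoffel_form k u v w = tangent_comp u (D v (push F w) u).
Proof.
move=> Uu; apply: (ip_k_inj Uu) => l.
rewrite (christoffel_ip sk kp v w (e l) Uu) tangent_comp_ip //.
have Dk a b z : ip ('D_a k u) b z = ip (h (F u)) (D a (push F b) u) (push F z u)
    + ip (h (F u)) (push F b u) (D a (push F z) u).
  rewrite -(derive_ip_cst b z a (smooth_on_diff sk Uu)) -(cip a Uu (sE b) (sE z)).
  by apply: (derive_ext _ oU Uu) => x Ux; rewrite kF.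
move: (Dk v w (e l)) (Dk w v (e l)) (Dk (e l) v w).
move: ('D_v k u) ('D_w k u) ('D_(e l) k u) => A1 A2 A3 -> -> ->.
rewrite (psym w v Uu) (psym (e l) v Uu) (psym (e l) w Uu).
rewrite (ips Uu (D v (push F (e l)) u)) (ips Uu (push F v u)).
move: (ip _ (D v (push F w) u) _) (ip _ (push F w u) _) (ip _ (D w _ u) (push F v u)).
move=> A B C; lra.
Qed.

Lemma levi_civita_cst v w u : U u ->
  levi_civita k (cst v) (cst w) u = tangent_comp u (D v (push F w) u).
Proof.
move=> Uu; rewrite -christoffel_tangent // /levi_civita.
by rewrite (_ : 'D_(cst v u) (cst w) u = 0) ?add0r //; exact: derive_cst.
Qed.

(** * Second fundamental form, mean curvature and tension field *)

Lemma sffE X Y u : second_fundamental_form k h F X Y u =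
  normal_comp u (D (X u) (pushforward F Y) u).
Proof. by rewrite /second_fundamental_form normal_partE pullback_connectionE. Qed.

Lemma sff_cst v w u : second_fundamental_form k h F (cst v) (cst w) u =
  normal_comp u (D v (push F w) u).
Proof. by rewrite sffE pushforward_cst. Qed.

Definition trace_B u := \sum_i \sum_j K u i j *: normal_comp u (D (e i) (E j) u).

Local Notation H := (mean_curvature k h F).

Lemma trace_sffE u : trace k (second_fundamental_form k h F) u = trace_B u.
Proof. by rewrite traceE; do 2!(apply: eq_bigr => ? _); rewrite sff_cst. Qed.

Lemma trace_B_mean u : trace_B u = n%:R *: H u.
Proof.
(* For [n = 0] the inverse [n%:R^-1] has the default value 0, and the identity holds because the sum
   is empty. *)
rewrite /mean_curvature trace_sffE scalerA; have [n0|n0] := eqVneq (n%:R : R) 0.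
  move: n0 => /eqP; rewrite pnatr_eq0 => /eqP n0.
  rewrite n0 mul0r scale0r /trace_B big1 // => i _.
  by have := ltn_ord i; rewrite [X in (_ < X)%N]n0.
by rewrite divff // scale1r.
Qed.

Lemma smooth_trace_B : smooth_on U trace_B.
Proof.
do 2!(apply: smooth_on_sum => // ?); apply: smooth_on_scale => //.
by apply: smooth_normal_comp; exact: sD.
Qed.

Lemma smooth_mean : smooth_on U H.
Proof.
apply: (@smooth_on_ext _ _ _ _ oU (fun u => n%:R^-1 *: trace_B u)).
  by move=> u _; rewrite /mean_curvature trace_sffE.
exact/smooth_onZ/smooth_trace_B.
Qed.

Lemma mean_normal u l : U u -> ip (h (F u)) (H u) (E l u) = 0.
Proof.
move=> Uu; rewrite /mean_curvature trace_sffE ipZl /trace_B ip_suml big1 ?mulr0 // => i _.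
by rewrite ip_suml big1 // => j _; rewrite ipZl normal_comp_ip // mulr0.
Qed.

Lemma tensionE u : U u -> tension k h F u = n%:R *: H u.
Proof.
move=> Uu; rewrite -trace_B_mean /tension traceE; do 2!(apply: eq_bigr => ? _).
rewrite pushforward_cst pullback_connectionE pushforwardE levi_civita_cst //.
Qed.

(** Minus the rough Laplacian, with the Levi-Civita term already written as a tangent component; at
    [H] it is [L] of the overview. *)
Definition second_trace V u : 'rV[R]_m := \sum_i \sum_j K u i j *:
  (D (e i) (D (e j) V) u - D (tangent_comp u (D (e i) (E j) u)) V u).

Lemma laplacian_pullback V u : U u ->
  laplacian k (pullback_connection h F) V u = - second_trace V u.
Proof.
move=> Uu; rewrite /laplacian traceE; congr (- _); do 2!(apply: eq_bigr => ? _).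
by rewrite !pullback_connection_cst pullback_connectionE levi_civita_cst.
Qed.

Lemma bitensionE u : U u -> bitension k h F u =
  n%:R *: (second_trace H u - \sum_i \sum_j K u i j *:
             curvature_at h (F u) (E i u) (H u) (E j u)).
Proof.
move=> Uu; rewrite /bitension laplacian_pullback // opprK scalerBr; congr (_ - _).
  have D1 v w : U w -> D v (tension k h F) w = n%:R *: D v H w.
    move=> Uw; rewrite -(connZ h F v n%:R Uw smooth_mean).
    by apply: (conn_ext h F oU v Uw) => x Ux; exact: tensionE.
  rewrite /second_trace scaler_sumr; apply: eq_bigr => i _; rewrite scaler_sumr.
  apply: eq_bigr => j _; rewrite scalerA mulrC -scalerA; congr (_ *: _).
  rewrite scalerBr; congr (_ - _).
    rewrite -(connZ h F (e i) n%:R Uu (sD (e j) smooth_mean)).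
    by apply: (conn_ext h F oU (e i) Uu) => x Ux; exact: D1.
  exact: D1.
rewrite traceE scaler_sumr; apply: eq_bigr => i _; rewrite scaler_sumr.
apply: eq_bigr => j _; rewrite scalerA mulrC -scalerA; congr (_ *: _).
by rewrite !pushforward_cst tensionE // (curvatureZr oU' sh hp) //; exact: FU.
Qed.

(** Weingarten formula: the derivative of the orthogonality relation, which is therefore assumed on
    all of [U]. *)
Lemma conn_normal V v w u : U u -> smooth_on U V ->
  (forall z l, U z -> ip (h (F z)) (V z) (E l z) = 0) ->
  ip (h (F u)) (D v V u) (push F w u) = - ip (h (F u)) (V u) (D v (push F w) u).
Proof.
move=> Uu sV V0; apply/eqP; rewrite -addr_eq0 -(cip v Uu sV (sE w)); apply/eqP.
transitivity ('D_v (fun=> 0 : R) u); last exact: derive_cst.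
apply: (derive_ext _ oU Uu) => x Ux; apply: ip_normal => // l; exact: V0.
Qed.

Let mean_conn v w u (Uu : U u) :=
  conn_normal v w Uu smooth_mean (fun z l Uz => mean_normal l Uz).

Lemma shape_operatorE V X u : shape_operator k h F V X u =
  raise u (fun a => ip (h (F u)) (normal_comp u (D (X u) (E a) u)) (V u)).
Proof.
rewrite /shape_operator traceE; do 2!(apply: eq_bigr => ? _).
by rewrite sffE pushforward_cst.
Qed.

Lemma shape_mean v u : U u -> shape_operator k h F H (cst v) u = - tangent_comp u (D v H u).
Proof.
move=> Uu; rewrite shape_operatorE; apply: (ip_k_inj Uu) => l.
rewrite raise_ip // ipNl tangent_comp_ip // mean_conn // opprK ips // ip_normal_comp //= => i.
exact: mean_normal.
Qed.

Lemma normal_connectionE X V u : normal_connection k h F X V u = normal_comp u (D (X u) V u).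
Proof. by rewrite /normal_connection normal_partE pullback_connectionE. Qed.

Lemma normal_connection_cst v V :
  normal_connection k h F (cst v) V = fun w => normal_comp w (D v V w).
Proof. by apply/funext => w; rewrite normal_connectionE. Qed.

(** Split [D_j H] into its normal and tangent components before applying [D_i]. The normal one
    yields the Laplacian of the normal connection; the tangent one is [- A_H e_j], and the normal
    part of its derivative is [- B(e_i, A_H e_j)]. *)
Lemma normal_comp_second_trace u : U u -> normal_comp u (second_trace H u) =
  - (laplacian k (normal_connection k h F) H u
     + trace k (fun X Y => second_fundamental_form k h F X (shape_operator k h F H Y)) u).
Proof.
move=> Uu; rewrite /laplacian !traceE opprD opprK /second_trace normal_comp_sum // -sumrB.
apply: eq_bigr => i _; rewrite normal_comp_sum // -sumrB; apply: eq_bigr => j _.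
rewrite normal_compZ // -scalerBr; congr (_ *: _).
rewrite !normal_connection_cst normal_connectionE levi_civita_cst // sffE.
rewrite (normal_compB _ _ Uu) [RHS]addrAC; apply: (congr1 (fun z => z - _)).
have sH := sD (e j) smooth_mean.
have sT : smooth_on U (fun w => push F (tangent_comp w (D (e j) H w)) w).
  by apply: smooth_push_field; exact: smooth_tangent_comp.
have -> : D (e i) (D (e j) H) u = D (e i) (fun w => normal_comp w (D (e j) H w)) u +
    D (e i) (fun w => push F (tangent_comp w (D (e j) H w)) w) u.
  rewrite -(connD h F (e i) Uu (smooth_normal_comp sH) sT).
  by apply: (conn_ext h F oU (e i) Uu) => x Ux; rewrite /normal_comp subrK.
rewrite normal_compD //; congr (_ + _); rewrite -normal_compN //; congr (normal_comp u _).
rewrite -(connN h F oU (e i) Uu); last first.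
  apply: (smooth_on_ext oU _ (smooth_onN oU sT)) => x Ux.
  by rewrite pushforwardE shape_mean // pushN.
apply: (conn_ext h F oU (e i) Uu) => x Ux.
by rewrite pushforwardE shape_mean // pushN // opprK.
Qed.

(** * Tangent part of the bitension field *)

Lemma derive_mulr (f g : 'rV[R]_n -> R) v u : U u -> smooth_on U f -> smooth_on U g ->
  'D_v (fun w => f w * g w) u = 'D_v f u * g u + f u * 'D_v g u.
Proof.
move=> Uu sf sg.
rewrite [LHS](deriveM (diff_derivable (smooth_on_diff sf Uu))
  (diff_derivable (smooth_on_diff sg Uu))) addrC; congr (_ + _).
exact: mulrC.
Qed.

Lemma derive_sumr (f : 'I_n -> 'rV[R]_n -> R) v u : U u -> (forall i, smooth_on U (f i)) ->
  'D_v (fun w => \sum_i f i w) u = \sum_i 'D_v (f i) u.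
Proof.
move=> Uu sf; have -> : (fun w => \sum_i f i w) = \sum_i f i.
  by apply/funext => w; rewrite fct_sumE.
by apply: derive_sum => i; exact: diff_derivable (smooth_on_diff (sf i) Uu).
Qed.

Lemma derive_gram v u a b : U u -> 'D_v k u a b =
  ip (h (F u)) (D v (E a) u) (E b u) + ip (h (F u)) (E a u) (D v (E b) u).
Proof.
move=> Uu; rewrite -(cip v Uu (sE (e a)) (sE (e b))).
rewrite (derive_entry _ _ _ (smooth_on_diff sk Uu)).
by apply: (derive_ext _ oU Uu) => z Uz; rewrite -kF // ip_delta.
Qed.

Lemma derive_invgram v u : U u ->
  'D_v (fun w => K w) u = - (K u *m 'D_v k u *m K u).
Proof.
move=> Uu; have uk w : U w -> k w \in unitmx by move=> /kp/posdef_unit.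
have sKm : smooth_on U (fun w => K w) by exact: smooth_on_invmx.
have : 'D_v (fun w => K w *m k w) u = 0.
  transitivity ('D_v (fun=> 1%:M : 'M[R]_n) u); last exact: derive_cst.
  by apply: (derive_ext _ oU Uu) => z Uz; rewrite mulVmx // uk.
rewrite (derive_mulmx _ (smooth_on_diff sKm Uu) (smooth_on_diff sk Uu)).
move: ('D_v (fun w => K w) u) ('D_v k u) => A B /eqP.
rewrite addr_eq0 => /eqP AB.
by rewrite -(mulmxK (uk _ Uu) A) AB mulNmx.
Qed.

Let b u i j := ip (h (F u)) (D (e i) (E j) u) (H u).

Lemma sqr_mean u : U u -> n%:R * ip (h (F u)) (H u) (H u) =
  \sum_i \sum_j K u i j * b u i j.
Proof.
move=> Uu; rewrite -ipZl -trace_B_mean /trace_B ip_suml; apply: eq_bigr => i _.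
rewrite ip_suml; apply: eq_bigr => j _; rewrite ipZl; congr (_ * _).
rewrite ips // ip_normal_comp //; first by rewrite ips.
by move=> l; exact: mean_normal.
Qed.

Lemma derive_sqr_mean v u : U u ->
  'D_v (sqr_norm h F H) u = 2 * ip (h (F u)) (D v H u) (H u).
Proof.
move=> Uu; have := cip v Uu smooth_mean smooth_mean; rewrite -[LHS]/('D_v (sqr_norm h F H) u).
by move=> ->; rewrite (ips Uu (H u)); lra.
Qed.

(** [n |H|^2 = tr_k h(D E, H)] differentiated, which avoids differentiating the
    Christoffel symbols of [k]. *)
Lemma derive_sqr_mean_trace l u : U u ->
  n%:R * ip (h (F u)) (D (e l) H u) (H u) =
  \sum_i \sum_j 'D_(e l) (fun w => K w) u i j * b u i j
  + \sum_i \sum_j K u i j * (ip (h (F u)) (D (e l) (D (e i) (E j)) u) (H u)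
      - ip (h (F u)) (D (e l) (push F (tangent_comp u (D (e i) (E j) u))) u) (H u)).
Proof.
move=> Uu; set x := D (e l) H u.
have sb i j : smooth_on U (fun w => b w i j).
  by apply: smip; [exact/sD/sE|exact: smooth_mean].
have sKb i j : smooth_on U (fun w => K w i j * b w i j) by exact: smooth_onM.
have sKm : smooth_on U (fun w => K w).
  by apply: smooth_on_invmx => // w /kp/posdef_unit.
have E1 : n%:R * (2 * ip (h (F u)) x (H u)) =
    \sum_i \sum_j ('D_(e l) (fun w => K w) u i j * b u i j + K u i j *
      (ip (h (F u)) (D (e l) (D (e i) (E j)) u) (H u)
       + ip (h (F u)) (D (e i) (E j) u) x)).
  rewrite -(derive_sqr_mean (e l) Uu).
  have sN : smooth_on U (sqr_norm h F H) := smip smooth_mean smooth_mean.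
  transitivity ('D_(e l) (fun w => n%:R * sqr_norm h F H w) u).
    rewrite (derive_mulr (e l) Uu (@smooth_on_cst R _ _ U (n%:R : R)) sN).
    by rewrite (_ : 'D_(e l) (fun=> n%:R : R) u = 0) ?mul0r ?add0r //; exact: derive_cst.
  transitivity ('D_(e l) (fun w => \sum_i \sum_j K w i j * b w i j) u).
    by apply: (derive_ext _ oU Uu) => w Uw; exact: sqr_mean.
  rewrite derive_sumr //; last by move=> i; apply: smooth_on_sum.
  apply: eq_bigr => i _; rewrite derive_sumr //; apply: eq_bigr => j _.
  rewrite (derive_mulr (e l) Uu (sK i j) (sb i j)).
  rewrite -(derive_entry (e l) i j (smooth_on_diff sKm Uu)).
  by rewrite (cip (e l) Uu (sD (e i) (sE (e j))) smooth_mean).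
(* The trace of the normal part of [D_i E_j] is [n H], which absorbs one of the two copies of
   [n h(x, H)] in [E1]; the tangent part is paired with [x = D_l H] and moved onto [H] by
   [mean_conn]. *)
have E2 : \sum_i \sum_j K u i j * ip (h (F u)) (D (e i) (E j) u) x =
    n%:R * ip (h (F u)) x (H u)
    - \sum_i \sum_j K u i j *
        ip (h (F u)) (D (e l) (push F (tangent_comp u (D (e i) (E j) u))) u) (H u).
  rewrite ips // -ipZl -trace_B_mean /trace_B ip_suml -sumrB; apply: eq_bigr => i _.
  rewrite ip_suml -sumrB; apply: eq_bigr => j _; rewrite ipZl -mulrBr; congr (_ * _).
  rewrite /normal_comp ipBl [X in _ = _ - X - _](ips Uu) mean_conn // (ips Uu (H u)).
  by rewrite opprK addrK.
move: E1; under eq_bigr do rewrite big_split /=.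
rewrite big_split /=.
have -> : \sum_i \sum_j K u i j * (ip (h (F u)) (D (e l) (D (e i) (E j)) u) (H u)
       + ip (h (F u)) (D (e i) (E j) u) x) =
  \sum_i \sum_j K u i j * ip (h (F u)) (D (e l) (D (e i) (E j)) u) (H u)
  + \sum_i \sum_j K u i j * ip (h (F u)) (D (e i) (E j) u) x.
  rewrite -big_split; apply: eq_bigr => i _; rewrite -big_split.
  by apply: eq_bigr => j _; rewrite mulrDr.
rewrite E2 => E1.
under [X in _ = _ + X]eq_bigr do (under eq_bigr do rewrite mulrBr; rewrite sumrB).
rewrite sumrB; lra.
Qed.

(** Symmetry moves [w] into the direction slot, where linearity is pointwise. *)
Lemma conn_push_row v w u : U u ->
  D v (push F w) u = \sum_a w 0 a *: D v (E a) u.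
Proof.
move=> Uu; rewrite (psym v w Uu) {1}(row_sum_delta w).
have D0 : D 0 (push F v) u = 0.
  by have := psym 0 v Uu; rewrite connE push0 // chr_form0l addr0 derive0.
have : forall r : seq 'I_n, D (\sum_(a <- r) w 0 a *: e a) (push F v) u =
    \sum_(a <- r) w 0 a *: D v (E a) u.
  elim=> [|a r IH]; first by rewrite !big_nil.
  by rewrite !big_cons (conn_dir_lin h sF _ _ _ Uu (sE v)) IH (psym _ v Uu).
exact.
Qed.

(** The derivative of [K] is [- K (C + C^T) K], and multiplying [C] by [K] on the right produces
    tangent components. Since [b] is symmetric, [Q] and its transpose contribute equally, whence the
    factor 2. *)
Lemma derive_invgram_trace l u : U u ->
  \sum_i \sum_j 'D_(e l) (fun w => K w) u i j * b u i j =
  - (2 * \sum_i \sum_j K u i j * \sum_c tangent_comp u (D (e l) (E j) u) 0 c * b u i c).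
Proof.
move=> Uu; pose C : 'M[R]_n := \matrix_(a, c) ip (h (F u)) (D (e l) (E a) u) (E c u).
pose Q := K u *m C *m K u.
have bs i j : b u i j = b u j i by rewrite /b (psym (e i) (e j) Uu).
have Ks : (K u)^T = K u by apply/matrixP => i j; rewrite mxE invmx_sym.
have -> : 'D_(e l) (fun w => K w) u = - (Q + Q^T).
  rewrite derive_invgram //; congr (- _).
  have -> : 'D_(e l) k u = C + C^T.
    by apply/matrixP => i j; rewrite derive_gram // !mxE (ips Uu (E i u)).
  by rewrite mulmxDr mulmxDl /Q !trmx_mul Ks mulmxA.
have -> : \sum_i \sum_j K u i j * \sum_c tangent_comp u (D (e l) (E j) u) 0 c * b u i c =
    \sum_i \sum_c Q i c * b u i c.
  apply: eq_bigr => i _.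
  transitivity (\sum_j \sum_c K u i j * (tangent_comp u (D (e l) (E j) u) 0 c * b u i c)).
    by apply: eq_bigr => j _; rewrite mulr_sumr.
  rewrite exchange_big; apply: eq_bigr => c _ /=.
  rewrite /Q -mulmxA mxE mulr_suml; apply: eq_bigr => j _.
  rewrite mulrA; congr (_ * _ * _); rewrite /tangent_comp raiseE mxE.
  by apply: eq_bigr => a _; rewrite mxE.
have QT : \sum_i \sum_j Q^T i j * b u i j = \sum_i \sum_j Q i j * b u i j.
  rewrite exchange_big; apply: eq_bigr => i _; apply: eq_bigr => j _.
  by rewrite mxE bs.
transitivity (- (\sum_i \sum_j Q i j * b u i j + \sum_i \sum_j Q^T i j * b u i j)).
  rewrite -big_split -sumrN; apply: eq_bigr => i _; rewrite -big_split -sumrN.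
  by apply: eq_bigr => j _ /=; rewrite !mxE mulNr mulrDl.
by rewrite QT; lra.
Qed.

(** The [k]-product with [e_l] of the trace of the shape operators of the normal derivatives of
    [H]. *)
Definition shape_trace l u := \sum_i \sum_j K u i j *
  ip (h (F u)) (normal_comp u (D (e j) (E l) u)) (normal_comp u (D (e i) H u)).

Let X1 l u := \sum_i \sum_j K u i j * ip (h (F u)) (D (e i) H u) (D (e j) (E l) u).

(** Split [D_j E_l]: its normal component gives [shape_trace], its tangent component gives, through
    [mean_conn], the very sum that differentiating [K] produces in [derive_invgram_trace]. The two
    cancel in [second_trace_tangent]. *)
Let X1E l u : U u -> X1 l u = shape_trace l u
  - \sum_i \sum_j K u i j * \sum_c tangent_comp u (D (e l) (E j) u) 0 c * b u i c.
Proof.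
move=> Uu; rewrite /shape_trace -sumrB; apply: eq_bigr => i _; rewrite -sumrB.
apply: eq_bigr => j _; rewrite -mulrBr; congr (_ * _).
rewrite (psym (e j) (e l) Uu); set y := D (e l) (E j) u.
rewrite ip_normal_comp //; last by move=> a; exact: normal_comp_ip.
rewrite /normal_comp ipBl (ips Uu y).
have -> : \sum_c tangent_comp u y 0 c * b u i c =
    ip (h (F u)) (H u) (D (e i) (push F (tangent_comp u y)) u).
  rewrite conn_push_row // ip_sumr; apply: eq_bigr => c _; rewrite ipZr; congr (_ * _).
  exact: ips.
by rewrite (ips Uu (push F _ u)) mean_conn // opprK addrK.
Qed.

(** [h(D_j H, E_l) = - h(H, D_j E_l)] differentiated once more; the ambient
    curvature comes from commuting [D_i] and [D_l] on [E_j]. *)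
Lemma second_trace_tangent l u : U u -> ip (h (F u)) (second_trace H u) (E l u) =
  - (2 * shape_trace l u) - n%:R * ip (h (F u)) (D (e l) H u) (H u)
  - \sum_i \sum_j K u i j *
      ip (h (F u)) (curvature_at h (F u) (E i u) (E l u) (E j u)) (H u).
Proof.
move=> Uu.
have T1 i j : ip (h (F u)) (D (e i) (D (e j) H) u) (E l u) =
    - ip (h (F u)) (D (e j) H u) (D (e i) (E l) u)
    - ip (h (F u)) (D (e i) H u) (D (e j) (E l) u)
    - ip (h (F u)) (D (e l) (D (e i) (E j)) u) (H u)
    - ip (h (F u)) (curvature_at h (F u) (E i u) (E l u) (E j u)) (H u).
  have : 'D_(e i) (fun w => ip (h (F w)) (D (e j) H w) (E l w)) u
      = 'D_(e i) (fun w => - ip (h (F w)) (H w) (D (e j) (E l) w)) u.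
    by apply: (derive_ext _ oU Uu) => w Uw; exact: mean_conn.
  rewrite (cip (e i) Uu (sD (e j) smooth_mean) (sE (e l))).
  have sN := smip smooth_mean (sD (e j) (sE (e l))).
  rewrite (deriveN (diff_derivable (smooth_on_diff sN Uu))).
  rewrite (cip (e i) Uu smooth_mean (sD (e j) (sE (e l)))).
  have -> : D (e i) (D (e j) (E l)) u = D (e l) (D (e i) (E j)) u
      + curvature_at h (F u) (E i u) (E l u) (E j u).
    transitivity (D (e i) (D (e l) (E j)) u).
      by apply: (conn_ext h F oU (e i) Uu) => w Uw; exact: psym.
    rewrite -(conn_commutator oU' sh hp oU sF FU (e i) (e l) Uu (sE (e j))).
    by rewrite addrC subrK.
  rewrite ipDr (ips Uu _ (H u)) (ips Uu (curvature_at _ _ _ _ _)).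
  move: (ip _ _ _) (ip _ _ _) (ip _ _ _) (ip _ _ _) (ip _ _ _) => *; lra.
have T2 i j : ip (h (F u)) (D (tangent_comp u (D (e i) (E j) u)) H u) (E l u) =
    - ip (h (F u)) (D (e l) (push F (tangent_comp u (D (e i) (E j) u))) u) (H u).
  by rewrite mean_conn // (psym _ (e l) Uu) ips.
have X1s : \sum_i \sum_j K u i j * ip (h (F u)) (D (e j) H u) (D (e i) (E l) u) = X1 l u.
  rewrite exchange_big; apply: eq_bigr => i _; apply: eq_bigr => j _.
  by rewrite invmx_sym.
have := derive_sqr_mean_trace l Uu; rewrite derive_invgram_trace // => E3.
transitivity (- X1 l u - X1 l u
  - \sum_i \sum_j K u i j * (ip (h (F u)) (D (e l) (D (e i) (E j)) u) (H u)
      - ip (h (F u)) (D (e l) (push F (tangent_comp u (D (e i) (E j) u))) u) (H u))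
  - \sum_i \sum_j K u i j *
      ip (h (F u)) (curvature_at h (F u) (E i u) (E l u) (E j u)) (H u)).
  rewrite -[X in - X - _ - _ - _]X1s /X1 /second_trace ip_suml -!sumrN -!big_split /=.
  apply: eq_bigr => i _; rewrite ip_suml -!sumrN -!big_split /=.
  by apply: eq_bigr => j _; rewrite ipZl ipBl T1 T2; ring.
rewrite X1E //; lra.
Qed.

(** The right-hand side is minus twice the curvature-free part of [second_trace_tangent]; this
    accounts for the coefficient 4 in the equation. *)
Lemma tangent_equation l u : U u ->
  ip (k u) (4 *: trace k (fun X Y => shape_operator k h F (normal_connection k h F X H) Y) u
            + n%:R *: grad k (sqr_norm h F H) u) (e l) =
  4 * shape_trace l u + 2 * (n%:R * ip (h (F u)) (D (e l) H u) (H u)).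
Proof.
move=> Uu; rewrite ipDl !ipZl; congr (_ * _ + _).
  rewrite traceE ip_suml; apply: eq_bigr => i _; rewrite ip_suml; apply: eq_bigr => j _.
  rewrite ipZl shape_operatorE raise_ip // normal_connectionE; congr (_ * ip _ _ _).
rewrite (_ : grad k (sqr_norm h F H) u = raise u (fun i => 'D_(e i) (sqr_norm h F H) u)) //.
by rewrite raise_ip // derive_sqr_mean //; ring.
Qed.

End Submanifold.

Lemma conn_comp {R : realType} {p m : nat} (h : 'rV[R]_m -> 'M[R]_m)
    (F : 'rV[R]_p -> 'rV[R]_m) (V : 'rV[R]_m -> 'rV[R]_m) v u :
  differentiable F u -> differentiable V (F u) ->
  conn h F v (fun w => V (F w)) u = conn h id (push F v u) V (F u).
Proof.
move=> dF dV; rewrite !conn.unlock derive_id push.unlock.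
by rewrite (derive_comp v dF dV).
Qed.

(** * Integral submanifolds *)

Section IntegralSubmanifold.
Context {R : realType} {n : nat}.
Local Notation m := (2 * n + 1)%N.
Variables (U' : set 'rV[R]_m) (h phi : 'rV[R]_m -> 'M[R]_m)
  (xi : 'rV[R]_m -> 'rV[R]_m) (eta : 'rV[R]_m -> 'cV[R]_m) (c : R).
Hypotheses (oU' : open U') (sh : smooth_on U' h) (hp : forall y, U' y -> posdef (h y))
  (sphi : smooth_on U' phi) (sxi : smooth_on U' xi)
  (phi2 : forall y, U' y -> phi y *m phi y = - 1%:M + eta y *m xi y)
  (etaxi : forall y, U' y -> pairing (eta y) (xi y) = 1)
  (mphi : forall y v w, U' y -> ip (h y) (v *m phi y) (w *m phi y) =
     ip (h y) v w - pairing (eta y) v * pairing (eta y) w)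
  (sas : forall y v (V : 'rV[R]_m -> 'rV[R]_m), U' y -> smooth_on U' V ->
     conn h id v (fun x => V x *m phi x) y - conn h id v V y *m phi y =
     ip (h y) v (V y) *: xi y - pairing (eta y) (V y) *: v)
  (curv : forall y v, U' y -> ip (h y) v v = 1 -> ip (h y) v (xi y) = 0 ->
     ip (h y) (curvature_at h y v (v *m phi y) (v *m phi y)) v = c).
Variables (U : set 'rV[R]_n) (F : 'rV[R]_n -> 'rV[R]_m) (k : 'rV[R]_n -> 'M[R]_n).
Hypotheses (oU : open U) (sF : smooth_on U F) (FU : forall u, U u -> U' (F u))
  (sk : smooth_on U k) (kp : forall u, U u -> posdef (k u))
  (kF : forall u v w, U u -> ip (k u) v w = ip (h (F u)) (push F v u) (push F w u))
  (integral : forall u v, U u -> pairing (eta (F u)) (push F v u) = 0).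
Implicit Types (u v w : 'rV[R]_n) (x y z : 'rV[R]_m).

Local Notation D := (conn h F).
Local Notation e := (delta_mx 0).
Local Notation K u := (invmx (k u)).
Local Notation E i := (push F (e i)).
Local Notation H := (mean_curvature k h F).
Local Notation tangent_comp := (tangent_comp h F k).
Local Notation normal_comp := (normal_comp h F k).
Local Notation kappa := ((c * (n%:R + 3) + 3 * n%:R - 3) / 4).

Section AtPoint.
Variable u : 'rV[R]_n.
Hypothesis Uu : U u.
Let Uy : U' (F u) := FU Uu.
Let G := h (F u).
Let P := phi (F u).
Let X := xi (F u).
Let p2 : P *m P = - 1%:M + eta (F u) *m X := phi2 Uy.
Let eX : pairing (eta (F u)) X = 1 := etaxi Uy.
Let mP x y : ip G (x *m P) (y *m P) = ip G x y -
  pairing (eta (F u)) x * pairing (eta (F u)) y := mphi x y Uy.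
Let ipX x : ip G x X = pairing (eta (F u)) x := ip_xi p2 eX mP x.
Let skew x y : ip G (x *m P) y = - ip G x (y *m P) := phi_skew p2 eX mP x y.
Let s x y : ip G x y = ip G y x := ip_sym x y (hp Uy).1.
Let XP : X *m P = 0 := xi_phi p2 eX.

(** Differentiate the orthogonality of [push F w] and [xi], with [D_v xi = - phi v]. *)
Let conn_push_xi v w : ip G (D v (push F w) u) X = ip G (push F w u) (push F v u *m P).
Proof.
have sX : smooth_on U (fun u => xi (F u)) by exact: smooth_on_comp oU oU' FU sF sxi.
have := conn_ip oU' sh hp sF FU v Uu (smooth_push sF w) sX.
have -> : 'D_v (fun w' => ip (h (F w')) (push F w w') (xi (F w'))) u = 0.
  transitivity ('D_v (fun=> 0 : R) u); last exact: derive_cst.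
  apply: (derive_ext _ oU Uu) => z Uz; have Uz' := FU Uz.
  by rewrite (ip_xi (phi2 Uz') (etaxi Uz') (fun x y => mphi x y Uz')) integral.
rewrite (conn_comp h v (smooth_on_diff sF Uu) (smooth_on_diff sxi Uy)).
rewrite (conn_xi oU' sh hp sxi phi2 etaxi mphi sas _ Uy) ipNr -/G -/X -/P.
by move=> E0; lra.
Qed.

(** [ip (D v E_w) xi] is symmetric in [v], [w] while [ip E_w (E_v phi)] is
    antisymmetric. *)
Let push_phi v w : ip G (push F v u) (push F w u *m P) = 0.
Proof.
have := conn_push_xi v w; have := conn_push_xi w v.
rewrite (conn_push_sym oU' sh hp oU sF FU v w Uu) => ->.
have := skew (push F v u) (push F w u); rewrite (s _ (push F w u)); lra.
Qed.

Let mean_xi : ip G (H u) X = 0.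
Proof.
rewrite /mean_curvature trace_sffE ipZl /trace_B ip_suml big1 ?mulr0 // => i _.
rewrite ip_suml big1 // => j _; rewrite ipZl /normal_comp ipBl conn_push_xi push_phi.
by rewrite ipX integral // subr0 mulr0.
Qed.

Let mean_E l : ip G (H u) (E l u) = 0.
Proof. exact: (mean_normal sF kp kF). Qed.

(** The [n + n + 1] vectors [E_i], [E_i phi], [xi] are independent, hence a basis. *)
Lemma frame_complete x : (forall v, ip G x (push F v u) = 0) ->
  (forall v, ip G x (push F v u *m P) = 0) -> ip G x X = 0 -> x = 0.
Proof.
move=> xE xP xX.
pose Fm : 'M[R]_(n, m) := \matrix_i E i u.
have FmE a : a *m Fm = push F a u.
  rewrite (push_row sF) // mulmx_sum_row; apply: eq_bigr => i _.
  by rewrite rowK.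
pose A := col_mx (col_mx Fm (Fm *m P)) X.
have freeA : row_free A.
  apply/inj_row_free => v; rewrite -[v]hsubmxK -[lsubmx v]hsubmxK.
  move: (lsubmx (lsubmx v)) (rsubmx (lsubmx v)) (rsubmx v) => a b t.
  rewrite !mul_row_col mulmxA !FmE => E0.
  have tX : t *m X = t 0 0 *: X by rewrite {1}[t]mx11_scalar mul_scalar_mx.
  (* Pairing a linear relation with [E_l], [phi E_l] and [xi] isolates [a], [b] and [t] in turn. *)
  have ipE z : ip G (push F a u) z + ip G (push F b u *m P) z + t 0 0 * ip G X z = 0.
    by rewrite -ipZl -!ipDl -tX E0 ip0l.
  have XE w : ip G X (push F w u) = 0 by rewrite s ipX integral.
  have a0 : a = 0.
    apply: (ip_nondeg (posdef_unit (kp Uu))) => l; rewrite kF //.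
    have := ipE (E l u); rewrite XE skew push_phi; lra.
  have b0 : b = 0.
    apply: (ip_nondeg (posdef_unit (kp Uu))) => l; rewrite kF //.
    have := ipE (E l u *m P); rewrite mP integral // mul0r subr0 push_phi.
    rewrite -[ip G X _]opprK -skew XP ip0l; lra.
  have t0 : t = 0.
    rewrite [t]mx11_scalar; have := ipE X.
    rewrite !ipX eX (eta_phi p2 eX) integral // => E1.
    by rewrite (_ : t 0 0 = 0) ?raddf0 //; lra.
  by rewrite a0 b0 t0 !row_mx0.
(* The number [n + n + 1] of independent rows equals the dimension [2 * n + 1]: here the dimension
   of the submanifold enters. *)
have fullA : row_full A.
  by move: freeA; rewrite /row_free /row_full => /eqP ->; apply/eqP; rewrite mul2n addnn.
have : A *m (x *m G)^T = 0.
  have z a : ip G x a = 0 -> a *m (x *m G)^T = 0.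
    move=> xa; rewrite [LHS]mx11_scalar -[in LHS](trmxK a) -trmx_mul mxE.
    by rewrite -[X in X%:M]/(ip G x a) xa raddf0.
  rewrite !mul_col_mx z // -mulmxA.
  have rowE B : (forall v, v *m Fm *m B = 0) -> Fm *m B = 0 :> 'M[R]_(_, 1).
    move=> h0; apply/row_matrixP => i; rewrite row_mul rowE h0 row0 //.
  rewrite !rowE ?col_mx0 //.
    by move=> v; rewrite mulmxA FmE z.
  by move=> v; rewrite FmE z.
rewrite -(mulmx0 _ A) => /(row_full_inj fullA) /(congr1 trmx).
rewrite trmxK trmx0 => xG.
by rewrite -(mulmxK (posdef_unit (hp Uy)) x) -/G xG mul0mx.
Qed.


Let horiz x := pairing (eta (F u)) x = 0.
Let Rm := curvature_at h (F u).
Let form := sasaki_form G P c.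

Let R1 (r : R) a a' b z : Rm (r *: a + a') b z = r *: Rm a b z + Rm a' b z.
Proof. exact: (curvature_lin1 oU' sh hp). Qed.
Let R12 a b z : Rm a b z = - Rm b a z.
Proof. exact: (curvature_antisym oU' sh hp). Qed.
Let RB a b z : Rm a b z + Rm b z a + Rm z a b = 0.
Proof. exact: (curvature_bianchi oU' sh hp). Qed.
Let R34 a b z t : ip G (Rm a b z) t = - ip G (Rm a b t) z.
Proof. exact: (curvature_skew oU' sh hp). Qed.
Let Rpair a b z t : ip G (Rm a b z) t = ip G (Rm z t a) b.
Proof. exact: (curvature_pair_sym R12 RB R34). Qed.

Let Rhoriz x x' y t : horiz x -> horiz x' -> horiz y -> horiz t ->
  ip G (Rm x y x') t + ip G (Rm x' y x) t = form x y x' t + form x' y x t.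
Proof.
apply: (curvature_horizontal_polar (hp Uy) p2 eX mP R1 R12 RB R34).
  by move=> a b z; exact: (curvature_phi oU' sh hp sphi sxi phi2 etaxi mphi sas).
by move=> a aa aX; exact: curv.
Qed.

Let push_horiz v : horiz (push F v u). Proof. exact: integral. Qed.
Let mean_horiz : horiz (H u). Proof. by rewrite /horiz -ipX mean_xi. Qed.

Let trace_sym (T : 'I_n -> 'I_n -> R) : (forall i j, T i j + T j i = 0) ->
  \sum_i \sum_j K u i j * T i j = 0.
Proof.
move=> Ts; have : \sum_i \sum_j K u i j * T i j = - \sum_i \sum_j K u i j * T i j.
  rewrite [in RHS]exchange_big -sumrN; apply: eq_bigr => i _; rewrite -sumrN.
  apply: eq_bigr => j _; rewrite (invmx_sym kp j i Uu) -mulrN; congr (_ * _).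
  by apply/eqP; rewrite -addr_eq0 Ts.
lra.
Qed.

(** [K] is symmetric, so the trace sees only the part symmetrized in [E_i], [E_j], which [Rhoriz]
    determines. *)
Let trace_horiz t : horiz t ->
  \sum_i \sum_j K u i j * ip G (Rm (E i u) (H u) (E j u)) t =
  \sum_i \sum_j K u i j * form (E i u) (H u) (E j u) t.
Proof.
move=> hw; apply/eqP; rewrite -subr_eq0 -sumrB; apply/eqP.
rewrite -[RHS](@trace_sym (fun i j => ip G (Rm (E i u) (H u) (E j u)) t
  - form (E i u) (H u) (E j u) t)).
  by apply: eq_bigr => i _; rewrite -sumrB; apply: eq_bigr => j _; rewrite mulrBr.
move=> i j; have := Rhoriz (push_horiz (e i)) (push_horiz (e j)) mean_horiz hw.
move: (ip G _ t) (ip G _ t) (form _ _ _ t) (form _ _ _ t) => a1 a2 a3 a4; lra.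
Qed.

(** The normal component of [phi H] is orthogonal to the frame: to [E_i] by construction, to
    [phi E_i] because phi preserves the product of [H] with [E_i], which is 0, and to [xi] because
    [eta phi = 0]. *)
Let phi_mean : push F (tangent_comp u (H u *m P)) u = H u *m P.
Proof.
apply/eqP; rewrite eq_sym -subr_eq0; apply/eqP; apply: frame_complete.
- by move=> v; exact: (normal_comp_ip sF kp kF).
- by move=> v; rewrite ipBl push_phi mP integral // mulr0 !subr0 (ip_normal sF v Uu mean_E).
- by rewrite ipBl !ipX integral // (eta_phi p2 eX) subrr.
Qed.

(** The trace of [k] itself contributes [n (c + 3) / 4]; the phi terms contribute [(c - 1) / 4] and
    [2 (c - 1) / 4]. The sum [(n (c + 3) + 3 (c - 1)) / 4] is [kappa]. *)
Lemma trace_curvature : \sum_i \sum_j K u i j *: Rm (E i u) (H u) (E j u) = - (kappa *: H u).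
Proof.
have ip_tr t : ip G (\sum_i \sum_j K u i j *: Rm (E i u) (H u) (E j u)) t =
    \sum_i \sum_j K u i j * ip G (Rm (E i u) (H u) (E j u)) t.
  rewrite ip_suml; apply: eq_bigr => i _; rewrite ip_suml; apply: eq_bigr => j _.
  exact: ipZl.
have trh t : horiz t -> \sum_i \sum_j K u i j * form (E i u) (H u) (E j u) t =
    - (kappa * ip G (H u) t).
  move=> hw.
  have Kk : \sum_i \sum_j K u i j * k u i j = n%:R.
    transitivity (\tr (K u *m k u)).
      apply: eq_bigr => i _; rewrite mxE; apply: eq_bigr => j _.
      by congr (_ * _); rewrite -{1}(kp Uu).1 mxE.
    rewrite mulVmx; last exact: posdef_unit (kp Uu).
    exact: mxtrace1.
  (* The sum is the expansion of the tangent vector [phi H] in the frame, to which phi is applied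
     once more: [phi^2 H = - H]. *)
  have Kphi : \sum_i \sum_j K u i j * (ip G (H u *m P) (E i u) * ip G (E j u *m P) t)
      = - ip G (H u) t.
    rewrite -ipNl -(_ : H u *m P *m P = - H u); last first.
      by rewrite (phi_phi p2) mean_horiz scale0r addr0.
    rewrite -[in RHS]phi_mean (push_row sF) // mulmx_suml ip_suml.
    rewrite exchange_big; apply: eq_bigr => j _ /=.
    rewrite -scalemxAl ipZl /tangent_comp raiseE mulr_suml; apply: eq_bigr => i _.
    by rewrite mulrA [K u i j * _]mulrC.
  have Kphi' : \sum_i \sum_j K u i j * (ip G (H u *m P) (E j u) * ip G (E i u *m P) t)
      = - ip G (H u) t.
    rewrite -Kphi exchange_big; apply: eq_bigr => i _; apply: eq_bigr => j _.
    by rewrite (invmx_sym kp j i Uu).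
  transitivity (- ((c + 3) / 4 * ip G (H u) t * \sum_i \sum_j K u i j * k u i j)
    + (c - 1) / 4 * (\sum_i \sum_j K u i j * (ip G (H u *m P) (E j u) * ip G (E i u *m P) t))
    + (c - 1) / 2 * (\sum_i \sum_j K u i j * (ip G (H u *m P) (E i u) * ip G (E j u *m P) t))).
    rewrite !mulr_sumr -sumrN -!big_split; apply: eq_bigr => i _ /=.
    rewrite !mulr_sumr -sumrN -!big_split; apply: eq_bigr => j _ /=.
    rewrite /form /sasaki_form mean_E push_phi -(ip_delta (k u)) kF // -/G.
    by rewrite (s (E j u) (H u *m P)) (s (E i u) (H u *m P)); field.
  rewrite Kk Kphi Kphi'; by field.
apply: (@ip_inj R m G) => [|z]; first exact: hp.
(* A test vector is a horizontal vector plus a multiple of [xi]; on [xi] both sides vanish, by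
   [curvature_xi] and because [H] is horizontal. *)
pose a := pairing (eta (F u)) z.
have -> : z = (z - a *: X) + a *: X by rewrite subrK.
have hz : horiz (z - a *: X).
  rewrite /horiz -ipX ipBl ipZl ipX -/a (ipX X) eX mulr1 subrr //.
rewrite !(ipDr G _ (z - _)) ip_tr trace_horiz // trh // ipNl ipZl; congr (_ + _).
rewrite !ipZr ipNl ipZl mean_xi mulr0 oppr0 ip_tr big1 // => i _.
rewrite big1 // => j _.
rewrite R34 /Rm (curvature_xi oU' sh hp sphi sxi phi2 etaxi mphi sas) //.
by rewrite integral // mean_horiz !scale0r subrr ip0l oppr0 mulr0.
Qed.

(** By pair symmetry this is the product with [E_l] of the curvature trace, which is a multiple of
    the normal vector [H]. *)
Lemma trace_curvature_tangent l : \sum_i \sum_j K u i j *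
  ip G (Rm (E i u) (E l u) (E j u)) (H u) = 0.
Proof.
transitivity (ip G (\sum_i \sum_j K u i j *: Rm (E i u) (H u) (E j u)) (E l u)).
  rewrite ip_suml exchange_big; apply: eq_bigr => i _; rewrite ip_suml.
  by apply: eq_bigr => j _; rewrite ipZl Rpair (invmx_sym kp j i Uu).
by rewrite trace_curvature ipNl ipZl mean_E mulr0 oppr0.
Qed.

Lemma bitension_eq0 : bitension k h F u = 0 <->
  laplacian k (normal_connection k h F) H u
    + trace k (fun Y Z => second_fundamental_form k h F Y (shape_operator k h F H Z)) u
    - kappa *: H u = 0
  /\ 4 *: trace k (fun Y Z => shape_operator k h F (normal_connection k h F Y H) Z) u
     + n%:R *: grad k (sqr_norm h F H) u = 0.
Proof.
rewrite (bitensionE oU' sh hp oU sF FU sk kp kF Uu) trace_curvature opprK.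
set L := second_trace h F k H u + _.
set e1 := _ - kappa *: H u; set e2 := 4 *: _ + _.
have Ln : normal_comp u L = - e1.
  rewrite (normal_compD h sF kp) // (normal_comp_second_trace oU' sh hp oU sF FU sk kp kF) //.
  rewrite (normal_comp_id sF kp Uu (x := kappa *: H u)) ?opprB 1?addrC //.
  by move=> l; rewrite ipZl mean_E mulr0.
have Lt l : 2 * ip G L (E l u) = - ip (k u) e2 (e l).
  rewrite ipDl ipZl mean_E mulr0 addr0.
  rewrite (second_trace_tangent oU' sh hp oU sF FU sk kp kF) // trace_curvature_tangent.
  rewrite (tangent_equation oU' sh hp oU sF FU sk kp) // -/G; lra.
(* For [n = 0] the bitension field carries the factor 0, so nothing can be deduced from its
   vanishing; both equations hold since all sums over ['I_n] are empty. *)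
have [n0|n0] := eqVneq (n%:R : R) 0.
  have no (i : 'I_n) : False.
    by move/eqP: n0 (ltn_ord i); rewrite pnatr_eq0 => /eqP {2}->.
  have L0 : L = 0.
    rewrite /L /mean_curvature /trace /second_trace !big1 ?scaler0 ?addr0 // => i;
    by have := no i.
  rewrite n0 scale0r; split=> // _; split; last by apply/rowP => i; have := no i.
  by apply: oppr_inj; rewrite -Ln L0 (normal_comp0 h sF kp) // oppr0.
split.
  move=> /eqP; rewrite scaler_eq0 (negbTE n0) /= => /eqP L0; split.
    by apply: oppr_inj; rewrite -Ln L0 (normal_comp0 h sF kp) // oppr0.
  apply: (ip_nondeg (posdef_unit (kp Uu))) => l.
  by apply: oppr_inj; rewrite -Lt L0 ip0l mulr0 oppr0.
move=> [e10 e20]; have L0 : normal_comp u L = L.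
  apply: (normal_comp_id sF kp Uu) => l; have := Lt l; rewrite e20 ip0l; rewrite -/G; lra.
by rewrite -L0 Ln e10 oppr0 scaler0.
Qed.

End AtPoint.
End IntegralSubmanifold.

(** * Domains of local expressions *)

Section LocalExpressions.
Context {R : realType} {n m : nat} {M : manifold R n} {N : manifold R m}.
Implicit Types (i : M -> N) (x : chart R M n) (y : chart R N m).

Lemma local_dom_sub i x y : local_dom i x y `<=` cod x.
Proof. by move=> _ [p [xp _] <-]; exists p. Qed.

Lemma local_expr_cod i x y u : local_dom i x y u -> cod y (local_expr i x y u).
Proof.
move=> [p [xp yp] <-]; exists (i p) => //.
by rewrite /local_expr /= coordK.
Qed.

(** [param x] is continuous within [cod x]; as this set is open, it is continuous at each of its
    points, and openness pulls back through [i] and [param x]. *)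
Lemma open_local_dom i x y : continuous i -> open (local_dom i x y).
Proof.
move=> ci; have -> : local_dom i x y = cod x `&` param x @^-1` (i @^-1` dom y).
  apply/seteqP; split=> [_ [p [xp yp] <-]|_ [[p xp <-]]].
    by split; [exists p|rewrite /= coordK].
  by rewrite /= coordK // => yp; exists p.
rewrite openE => u [cu yu].
have oi : open (i @^-1` dom y) by apply: open_comp; [move=> p _; exact: ci|exact: open_dom].
have cp : {for u, continuous (param x)}.
  have := @param_continuous _ _ _ x; rewrite continuous_open_subspace; last exact: open_cod.
  by apply; rewrite inE.
apply: filterI; first by apply: open_nbhs_nbhs; split; [exact: open_cod|].
by apply: cp; exact: open_nbhs_nbhs.
Qed.

End LocalExpressions.

Lemma posdef_metric {R : realType} {m : nat} {N : manifold R m}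
    (g : riemannian_metric N) x u :
  atlas x -> cod x u -> posdef (g x u).
Proof. by move=> ax xu; split; [exact: Defs.metric_sym|move=> v; exact: metric_pos]. Qed.


Theorem theorem3p1 (R : realType) (n : nat) (c : R)
    (N : manifold R (2 * n + 1)) (S : contact_metric N)
    (hS : sasakian_space_form S c)
    (M : manifold R n) (gM : riemannian_metric M) (i : M -> N)
    (hi : isometric_immersion gM (cm_metric S) i)
    (hint : integral_map (cm_eta S) i) :
  biharmonic gM (cm_metric S) i <->
  (forall (x : chart R M n) (y : chart R N (2 * n + 1)) (u : 'rV[R]_n),
     atlas x -> atlas y -> local_dom i x y u ->
     let k := gM x in
     let h := cm_metric S y in
     let F := local_expr i x y in
     let B := second_fundamental_form k h F in
     let A := shape_operator k h F in
     let nablaP := normal_connection k h F in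
     let H := mean_curvature k h F in
     laplacian k nablaP H u
       + trace k (fun X Y => B X (A H Y)) u
       - ((c * (n%:R + 3) + 3 * n%:R - 3) / 4) *: H u = 0
     /\
     4 *: trace k (fun X Y => A (nablaP X H) Y) u
       + n%:R *: grad k (sqr_norm h F H) u = 0).
Proof.
have E x y u : atlas x -> atlas y -> local_dom i x y u ->
    let F := local_expr i x y in let k := gM x in let h := cm_metric S y in
    let H := mean_curvature k h F in
    bitension k h F u = 0 <->
    laplacian k (normal_connection k h F) H u
      + trace k (fun Y Z => second_fundamental_form k h F Y (shape_operator k h F H Z)) u
      - ((c * (n%:R + 3) + 3 * n%:R - 3) / 4) *: H u = 0
    /\ 4 *: trace k (fun Y Z => shape_operator k h F (normal_connection k h F Y H) Z) u
       + n%:R *: grad k (sqr_norm h F H) u = 0.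
  move=> ax ay Uu F k h H; have [[ci si] iso] := hi.
  have [sas curv] := hS.
  apply: (@bitension_eq0 R n (cod y) h (cm_phi S y) (cm_xi S y) (cm_eta S y) c
    _ _ _ _ _ _ _ _ _ _ (local_dom i x y) F k _ _ _ _ _ _ _ u Uu).
  - exact: open_cod.
  - exact: metric_smooth.
  - by move=> z; exact: posdef_metric.
  - exact: t11_smooth.
  - exact: vf_smooth.
  - by move=> z Uz; exact: phi_sqr.
  - by move=> z Uz; exact: eta_xi.
  - by move=> z v w Uz; exact: metric_phi.
  - move=> z v V Uz sV.
    (* [sasakian] speaks of vector fields: a direction [v] is extended to the constant field. *)
    have sc : smooth_on (cod y) (fun=> v) by exact: smooth_on_cst.
    by rewrite -(sas y z (fun=> v) V ay Uz sc sV) !levi_civitaE.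
  - move=> z v Uz vv vX.
    have Gp := posdef_metric (cm_metric S) ay Uz.
    have [p2 eX] := (phi_sqr S ay Uz, eta_xi S ay Uz).
    have mP a b := metric_phi S a b ay Uz.
    (* For a unit horizontal [v] the pair [v], [phi v] is orthonormal, so the denominator of the
       sectional curvature is 1. *)
    rewrite -(curv y z v ay Uz vv vX) /sectional_curvature mP vv.
    rewrite -(ip_xi p2 eX mP) vX (ip_phi_self Gp p2 eX mP).
    by rewrite mulr0 subr0 mulr1 expr0n subr0 divr1.
  - exact: open_local_dom.
  - exact: si.
  - by move=> z; exact: local_expr_cod.
  - apply: smooth_on_subset (metric_smooth gM ax); exact: local_dom_sub.
  - by move=> z /local_dom_sub; exact: posdef_metric.
  - by move=> z v w Uz; rewrite push.unlock; exact: iso.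
  - by move=> z v Uz; rewrite push.unlock; exact: hint.
split=> [b x y u ax ay Uu|b x y u ax ay Uu].
  exact: (E x y u ax ay Uu).1 (b x y u ax ay Uu).
exact: (E x y u ax ay Uu).2 (b x y u ax ay Uu).
Qed.
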